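(* For all integers $2\leq m\leq r$ and $\alpha>0$ there is $\rho>0$ such that for every $s\geq m$ there is an $n_0$ with the following property. Let $H$ be a fissile $m$-digraph on $n\geq n_0$ vertices with $n$ divisible by $m$. Suppose that $H$ $r$-robustly satisfies $\mathsf{Div}\cap\mathsf{Cov}$, and that $H-A$ $s$-robustly satisfies $\mathsf{Spa}_\rho$ for every set $A\subseteq V(H)$ of at most $\alpha n$ vertices. Then $H$ has a perfect matching.
   Context: An $m$-digraph $H$ consists of a finite vertex set $V(H)$ and an edge set $E(H)\subseteq V(H)^m$; edges are $m$-tuples and may contain repeated vertices. We write $e\in H$ for $e\in E(H)$. For a tuple $e$, $\mathrm{m}(v,e)=|\{i: e(i)=v\}|$. A tuple is injective if it has no repeated entries. For $S\subseteq V(H)$, $H[S]$ is the $m$-digraph on $S$ with all edges of $H$ having all entries in $S$, and $H-S=H[V(H)\setminus S]$. A matching in $H$ is a set of injective edges such that no vertex is covered twice; it is perfect if every vertex of $H$ is covered. Properties: $\mathsf{Div}$ is the set of digraphs $H$ admitting $w\colon E(H)\to\mathbb{Z}$ with $\sum_{e\in H}w(e)\,\mathrm{m}(v,e)=1$ for every $v\in V(H)$. $\mathsf{Cov}$ is the set of digraphs $H$ such that for every $v\in V(H)$ there is an edge $e\in H$ with $\mathrm{m}(v,e)=1$. A fractional matching in an $m$-digraph $H$ on $n$ vertices is $w\colon E(H)\to[0,1]$ with $\sum_{e\in H}w(e)\,\mathrm{m}(v,e)\leq1$ for every $v$; its size is $\sum_{e\in H}w(e)\leq n/m$, and it is $\rho$-perfect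 if its size is at least $(1-\rho)n/m$. $\mathsf{Spa}_\rho$ is the set of uniform digraphs with a $\rho$-perfect fractional matching. Fissility: Let $R$ be an $m$-digraph and $\mathcal{V}=\{V_x\}_{x\in V(R)}$ a family of pairwise disjoint non-empty sets. For $f\in R$, an $m$-tuple $e\in(\bigcup\mathcal{V})^m$ is $f$-preserving if $e(i)\in V_{f(i)}$ for all $1\leq i\leq m$, and strictly $f$-preserving if in addition $e(i)=e(j)$ whenever $f(i)=f(j)$. The blow-up $R(\mathcal{V})$ is the $m$-digraph on $\bigcup\mathcal{V}$ containing, for every $f\in R$, all strictly $f$-preserving $m$-tuples as edges. An edge $f\in R$ is ample if $|V_{f(i)}|\geq \mathrm{m}(f(i),f)$ for each $1\leq i\leq m$. An $m$-digraph $H$ is fissile if for every blow-up $R(\mathcal{V})\subseteq H$ and every ample $f\in R$ there is an $f$-preserving injective edge in $H$. Robustness: For an $m$-digraph $H$ and a family $\mathsf{P}$ of $m$-digraphs, the property graph $P^{(t)}(H;\mathsf{P})$ is the $t$-uniform hypergraph on $V(H)$ whose edges are the $t$-sets $S\subseteq V(H)$ with $H[S]\in\mathsf{P}$. A digraph $H$ on $N$ vertices $t$-robustly satisfies $\mathsf{P}$ if every vertex lies in at least $(1-1/t^2)\binom{N-1}{t-1}$ edges of $P^{(t)}(H;\mathsf{P})$. *)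

(* Defs.v *)
From HB Require Import structures.
From mathcomp Require Import all_boot all_order all_algebra.
From mathcomp Require Import boolp reals.

Set Implicit Arguments.
Unset Strict Implicit.
Unset Printing Implicit Defensive.

Import Order.TTheory GRing.Theory Num.Theory.

Local Open Scope ring_scope.

(* The vertex set is a subset of an ambient finite type, so that induced
   subdigraphs and subdigraphs live on the same type. *)
Record mdigraph (m : nat) (T : finType) := MDigraph {
  verts : {set T};
  edges : {set m.-tuple T};
  edges_verts : forall e, e \in edges -> forall i, tnth e i \in verts
}.

Definition mult (m : nat) (T : finType) (v : T) (e : m.-tuple T) : nat :=
  #|[set i : 'I_m | tnth e i == v]|.

Section Induced.
Variables (m : nat) (T : finType) (H : mdigraph m T) (S : {set T}).

Let induced_edges :=
  [set e in edges H | [forall i, tnth e i \in S]].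

Fact induced_subproof e :
  e \in induced_edges -> forall i, tnth e i \in S.
Proof. by rewrite inE => /andP[_ /forallP]. Qed.

(* Only meaningful for S \subset verts H. *)
Definition induced : mdigraph m T := MDigraph induced_subproof.

End Induced.

Definition remove (m : nat) (T : finType) (H : mdigraph m T) (A : {set T}) :
  mdigraph m T := induced H (verts H :\: A).

Definition subdigraph (m : nat) (T : finType) (G H : mdigraph m T) : Prop :=
  verts G \subset verts H /\ edges G \subset edges H.

Section Matchings.
Variables (m : nat) (T : finType) (H : mdigraph m T).

Definition is_matching (M : {set m.-tuple T}) : Prop :=
  [/\ M \subset edges H,
      forall e, e \in M -> uniq e &
      forall e f, e \in M -> f \in M -> e != f ->
        forall v, ~~ ((v \in e) && (v \in f))].

Definition is_perfect_matching (M : {set m.-tuple T}) : Prop :=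
  is_matching M /\
  forall v, v \in verts H -> exists2 e, e \in M & v \in e.

Definition has_perfect_matching : Prop := exists M, is_perfect_matching M.

Definition Div : Prop :=
  exists w : m.-tuple T -> int,
    forall v, v \in verts H ->
      \sum_(e in edges H) w e * (mult v e)%:R = 1.

Definition Cov : Prop :=
  forall v, v \in verts H -> exists2 e, e \in edges H & mult v e = 1%N.

(* Only the values of w on edges H matter, here and in Div. *)
Definition is_fractional_matching (K : realType) (w : m.-tuple T -> K) : Prop :=
  (forall e, e \in edges H -> 0 <= w e <= 1) /\
  (forall v, v \in verts H ->
     \sum_(e in edges H) w e * (mult v e)%:R <= 1).

Definition Spa (K : realType) (rho : K) : Prop :=
  exists w : m.-tuple T -> K,
    is_fractional_matching w /\
    (1 - rho) * #|verts H|%:R / m%:R <= \sum_(e in edges H) w e.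

End Matchings.

Section BlowUp.
Variables (m : nat) (U T : finType) (R : mdigraph m U) (V : U -> {set T}).

Definition preserving (f : m.-tuple U) (e : m.-tuple T) : bool :=
  [forall i, tnth e i \in V (tnth f i)].

Definition strictly_preserving (f : m.-tuple U) (e : m.-tuple T) : bool :=
  preserving f e &&
  [forall i, forall j, (tnth f i == tnth f j) ==> (tnth e i == tnth e j)].

Definition ample (f : m.-tuple U) : bool :=
  [forall i, mult (tnth f i) f <= #|V (tnth f i)|]%N.

Let blowup_verts := \bigcup_(x in verts R) V x.

Let blowup_edges :=
  [set e | [exists f in edges R, strictly_preserving f e]].

Fact blowup_subproof e :
  e \in blowup_edges -> forall i, tnth e i \in blowup_verts.
Proof.
rewrite inE => /existsP[f /and3P[fR /forallP fe _]] i.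
by apply/bigcupP; exists (tnth f i); [exact: edges_verts | exact: fe].
Qed.

Definition blowup : mdigraph m T := MDigraph blowup_subproof.

Definition blowup_family : Prop :=
  (forall x, x \in verts R -> V x != set0) /\
  (forall x y, x \in verts R -> y \in verts R -> x != y ->
     [disjoint V x & V y]).

End BlowUp.

Definition fissile (m : nat) (T : finType) (H : mdigraph m T) : Prop :=
  forall (U : finType) (R : mdigraph m U) (V : U -> {set T}),
    blowup_family R V -> subdigraph (blowup R V) H ->
    forall f, f \in edges R -> ample V f ->
      exists e, [/\ e \in edges H, preserving V f e & uniq e].

Definition property_graph (m : nat) (T : finType) (t : nat)
    (H : mdigraph m T) (P : mdigraph m T -> Prop) : {set {set T}} :=
  [set S : {set T} | [&& S \subset verts H, #|S| == t & `[< P (induced H S) >]]].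

Definition robustly (K : realType) (m : nat) (T : finType) (t : nat)
    (P : mdigraph m T -> Prop) (H : mdigraph m T) : Prop :=
  forall v, v \in verts H ->
    (1 - 1 / t%:R ^+ 2 : K) * 'C(#|verts H| - 1, t - 1)%:R
      <= #|[set S in property_graph t H P | v \in S]|%:R.

(* Main.v *)
(** The proof is by absorption. Both halves find a bounded configuration with
    positive density whose isomorphism type ("pattern") is constant on a positive
    proportion of lists; Jensen's inequality then yields complete blow-ups of it, and
    fissility turns any multiset of pattern edges fitting into the blown-up parts
    into a matching of [H].

    Covering: let [M] be a maximum matching of [H - A] leaving more than a proportion
    [rho] uncovered. Cut the uncovered vertices into [m]-tuples, and call these tuples
    and the edges of [M] columns. For [s] random columns, the first one uncovered,
    picking one entry per column gives an [s]-set in the property graph with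
    probability close to at least [1 - 1 / s ^ 2]. Averaging the fractional matchings
    of these sets gives, in expectation, a fractional matching on the [s] columns of
    larger size than the number of columns in [M]; blowing up contradicts maximality.

    Absorbing: given an [m]-set [X] and a hub [h], choose disjoint sets [T_x], for [x] in
    [X] or [x = h], with [x + T_x] in the property graph, and for each [t] in them a set
    [T_t] such that both [t + T_t] and [h + T_t] are. By [Div] the lattice
    generated by edge vectors contains all [1_t - 1_h], and [Cov] gives edges
    [1_x + a_x] with [a_x] supported on [T_x]. As [1_h + a_h] is in the lattice, so is
    [m 1_h], hence the sum of the [a_x] over [X]; a blow-up then absorbs [X]. *)

Require Import Defs.
From mathcomp Require Import all_boot all_order all_algebra.
From mathcomp Require Import boolp reals.
From mathcomp Require Import zify ring lra.

Import Order.TTheory GRing.Theory Num.Theory.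

Local Open Scope ring_scope.

Set Implicit Arguments.
Unset Strict Implicit.
Unset Printing Implicit Defensive.

(** * Averages over lists *)

Section Average.
Variable K : realFieldType.

Lemma sum_seq_ge_exists (C : eqType) (D : seq C) (f : C -> K) (c : K) :
  (0 < size D)%N -> c * (size D)%:R <= \sum_(x <- D) f x ->
  exists2 x, x \in D & c <= f x.
Proof.
move=> D0 le_c; have [/hasP[x xD cx]|/hasPn nD] := boolP (has (fun x => c <= f x) D).
  by exists x.
suff: \sum_(x <- D) f x < c * (size D)%:R by rewrite ltNge le_c.
have -> : c * (size D)%:R = \sum_(x <- D) c.
  by rewrite big_const_seq iter_addr_0 count_predT mulr_natr.
rewrite big_seq [ltRHS]big_seq; apply: ltr_sum => [|x /nD].
  have [x xD] : exists x, x \in D.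
    by case: (D) D0 => // x s _; exists x; rewrite inE eqxx.
  by apply/hasP; exists x.
by rewrite ltNge.
Qed.

(** The power function lies above its tangent at [a]. In the inductive step, multiplying by [x]
    leaves the surplus [(n + 1) a ^ n (x - a) ^ 2]. *)
Lemma bernoulli_tangent (x a : K) n : 0 <= x -> 0 <= a ->
  a ^+ n.+1 + n.+1%:R * a ^+ n * (x - a) <= x ^+ n.+1.
Proof.
move=> x0 a0; elim: n => [|n IH]; first by rewrite expr0 !expr1; lra.
have h : 0 <= n.+1%:R * a ^+ n * (x - a) ^+ 2.
  by apply: mulr_ge0 (sqr_ge0 _); rewrite mulr_ge0 ?exprn_ge0.
have {IH} := ler_wpM2l x0 IH; rewrite -exprS; apply: le_trans.
rewrite -subr_ge0; apply: le_trans h _; rewrite le_eqVlt; apply/orP; left.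
by apply/eqP; rewrite !exprS -[n.+2%:R]natr1; ring.
Qed.

Lemma bernoulli_pow (x : K) n : 0 <= x <= 1 -> 1 - n%:R * x <= (1 - x) ^+ n.
Proof.
move=> /andP[x0 x1]; case: n => [|n]; first by rewrite mul0r subr0 expr0.
have y0 : 0 <= 1 - x by rewrite subr_ge0.
by have := bernoulli_tangent n y0 ler01; rewrite !expr1n mulr1; apply: le_trans; lra.
Qed.

Section Def.
Variables (C : eqType) (D : seq C).

(** The expectation over [k] independent uniform draws from [D], repetitions allowed. Independence
    makes product formulas exact; the cost of repeated entries is paid separately through
    [avg_nuniq]. *)
Fixpoint avg (k : nat) (F : seq C -> K) : K :=
  if k is k'.+1 then
    (\sum_(x <- D) avg k' (fun l => F (x :: l))) / (size D)%:R
  else F [::].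

Lemma avgS k F :
  avg k.+1 F = (\sum_(x <- D) avg k (fun l => F (x :: l))) / (size D)%:R.
Proof. by []. Qed.

Lemma avg_le k F G :
  (forall l, size l = k -> {subset l <= D} -> F l <= G l) -> avg k F <= avg k G.
Proof.
elim: k F G => [|k IH] F G FG /=; first exact: FG.
rewrite ler_wpM2r ?invr_ge0 ?ler0n //.
rewrite big_seq [leRHS]big_seq; apply: ler_sum => x xD.
apply: IH => l sl lD; apply: FG; rewrite /= ?sl // => y.
by rewrite inE => /predU1P[->|/lD].
Qed.

Lemma eq_avg k F G :
  (forall l, size l = k -> {subset l <= D} -> F l = G l) -> avg k F = avg k G.
Proof.
by move=> FG; apply/eqP; rewrite eq_le !avg_le // => l sl lD; rewrite FG.
Qed.

Lemma avgD k F G : avg k (fun l => F l + G l) = avg k F + avg k G.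
Proof.
elim: k F G => [|k IH] F G //=; rewrite -mulrDl -big_split /=.
by congr (_ / _); apply: eq_bigr => x _; rewrite IH.
Qed.

Lemma avgZ k c F : avg k (fun l => c * F l) = c * avg k F.
Proof.
elim: k F => [|k IH] F //=; rewrite mulrA mulr_sumr.
by congr (_ / _); apply: eq_bigr => x _; rewrite IH.
Qed.

Lemma avg_sub k F G : avg k (fun l => F l - G l) = avg k F - avg k G.
Proof.
rewrite avgD -mulN1r -avgZ; congr (_ + _).
by apply: eq_avg => l _ _; rewrite mulN1r.
Qed.

Lemma avg0 k : avg k (fun=> 0) = 0.
Proof.
by rewrite -[RHS](mul0r (avg k (fun=> 0))) -avgZ; apply: eq_avg => *; rewrite mul0r.
Qed.

Lemma avg_sum (I : Type) (r : seq I) (P : pred I) k (F : I -> seq C -> K) :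
  avg k (fun l => \sum_(i <- r | P i) F i l) = \sum_(i <- r | P i) avg k (F i).
Proof.
elim: r => [|i r IH].
  by rewrite big_nil -[RHS](avg0 k); apply: eq_avg => l; rewrite big_nil.
rewrite big_cons -IH; case Pi: (P i).
  by rewrite -avgD; apply: eq_avg => l _ _; rewrite big_cons Pi.
by apply: eq_avg => l _ _; rewrite big_cons Pi.
Qed.

Lemma avg_cat a b F :
  avg (a + b) F = avg a (fun t => avg b (fun l => F (t ++ l))).
Proof.
elim: a F => [|a IH] F //=; congr (_ / _).
by apply: eq_bigr => x _; rewrite IH.
Qed.

Lemma avg_ge0 k F :
  (forall l, size l = k -> {subset l <= D} -> 0 <= F l) -> 0 <= avg k F.
Proof. by move=> F0; rewrite -(avg0 k) avg_le. Qed.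

Hypothesis D0 : (0 < size D)%N.

Let sD0 : (size D)%:R != 0 :> K. Proof. by rewrite pnatr_eq0 -lt0n. Qed.

Lemma avg_const k c : avg k (fun=> c) = c.
Proof.
elim: k => //= k ->; rewrite big_const_seq iter_addr_0 count_predT.
by rewrite -[c *+ _]mulr_natr mulfK.
Qed.

Lemma avg_exists k F c : c <= avg k F ->
  exists l, [/\ size l = k, {subset l <= D} & c <= F l].
Proof.
elim: k F => [|k IH] F /=; first by exists [::].
rewrite ler_pdivlMr ?ltr0n // => /(sum_seq_ge_exists D0)[x xD /IH[l [sl lD cl]]].
exists (x :: l); split; rewrite /= ?sl // => y.
by rewrite inE => /predU1P[->|/lD].
Qed.

(** The tangent at the mean, from [bernoulli_tangent], is averaged; its linear term vanishes. *)
Lemma avg_jensen k F b :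
  (forall l, size l = k -> {subset l <= D} -> 0 <= F l) ->
  avg k F ^+ b <= avg k (fun l => F l ^+ b).
Proof.
move=> F0; case: b => [|b]; first by rewrite expr0 avg_const.
set a := avg k F; have a0 : 0 <= a by exact: avg_ge0.
have: avg k (fun l => a ^+ b.+1 + b.+1%:R * a ^+ b * (F l - a)) <=
      avg k (fun l => F l ^+ b.+1).
  by apply: avg_le => l sl lD; apply: bernoulli_tangent => //; exact: F0.
by rewrite avgD avgZ avg_sub !avg_const subrr mulr0 addr0.
Qed.

Lemma avg_prod b (f : C -> K) :
  avg b (fun t => \prod_(x <- t) f x) =
    ((\sum_(x <- D) f x) / (size D)%:R) ^+ b.
Proof.
elim: b => [|b IH] /=; first by rewrite big_nil expr0.
rewrite exprS -IH mulrAC; congr (_ / _); rewrite mulr_suml.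
by apply: eq_bigr => x _; rewrite -avgZ; apply: eq_avg => l _ _; rewrite big_cons.
Qed.

Lemma avg_nth k (f : C -> K) x0 j : (j < k)%N ->
  avg k (fun l => f (nth x0 l j)) = (\sum_(x <- D) f x) / (size D)%:R.
Proof.
elim: k j => // k IH [_|j jk] /=.
  by congr (_ / _); apply: eq_bigr => x _; rewrite avg_const.
under eq_bigr do rewrite (IH j) //.
rewrite big_const_seq iter_addr_0 count_predT -[X in X / _]mulr_natr.
by rewrite mulfK.
Qed.

(** The chain rule for conditional probabilities: [G] may depend on the first [a] draws, and its
    lower bound is required only where [F] does not vanish. *)
Lemma avg_mul a b F G p q : 0 <= p -> 0 <= q ->
  (forall t, 0 <= F t) -> p <= avg a F ->
  (forall t, size t = a -> {subset t <= D} -> F t != 0 -> q <= avg b (G t)) ->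
  p * q <= avg (a + b) (fun l => F (take a l) * G (take a l) (drop a l)).
Proof.
move=> p0 q0 F0 pF qG; rewrite avg_cat.
apply: le_trans (_ : avg a (fun t => q * F t) <= _).
  by rewrite avgZ mulrC ler_wpM2l.
apply: avg_le => t st tD.
rewrite (@eq_avg _ _ (fun l => F t * G t l)); last first.
  by move=> l _ _; rewrite take_size_cat // drop_size_cat.
rewrite avgZ mulrC; have [->|Ft] := eqVneq (F t) 0; first by rewrite !mul0r.
by rewrite ler_wpM2l // qG.
Qed.

End Def.

Lemma avg_exchange (C C' : eqType) (D : seq C) (D' : seq C') k k' F :
  avg D k (fun l => avg D' k' (F l)) =
  avg D' k' (fun l' => avg D k (fun l => F l l')).
Proof.
elim: k F => [|k IH] F //=.
under eq_bigr do rewrite IH.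
rewrite -avg_sum mulrC -avgZ; apply: eq_avg => l _ _.
by rewrite mulrC.
Qed.

(** Union bound over the [k] draws. *)
Lemma avg_hit (C : eqType) (D : seq C) (B : pred C) k : (0 < size D)%N ->
  avg D k (fun l => (has B l)%:R) <= k%:R * (count B D)%:R / (size D)%:R.
Proof.
move=> D0; have sD0 : (size D)%:R != 0 :> K by rewrite pnatr_eq0 -lt0n.
elim: k => [|k IH]; first by rewrite /= !mul0r.
set p := k%:R * _ / _ in IH.
have -> : k.+1%:R * (count B D)%:R / (size D)%:R =
    (\sum_(x <- D) ((B x)%:R + p)) / (size D)%:R :> K.
  rewrite big_split /= big_const_seq iter_addr_0 count_predT -[p *+ _]mulr_natr.
  rewrite /p mulfVK // -natr1 mulrDl mul1r addrC; congr ((_ + _) / _).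
  by rewrite -sum1_count natr_sum big_mkcond; apply: eq_bigr => x _; case: (B x).
rewrite avgS ler_wpM2r ?invr_ge0 //; apply: ler_sum => x _.
apply: le_trans (_ : (B x)%:R + avg D k (fun l => (has B l)%:R) <= _); last first.
  by rewrite lerD2l.
rewrite -{1}(@avg_const _ _ D0 k (B x)%:R) -avgD; apply: avg_le => l _ _.
by rewrite -natrD ler_nat /=; case: (B x); case: (has B l).
Qed.

(** Birthday bound: the head reappears among [k] further draws with probability at most
    [k / |D|]. *)
Lemma avg_nuniq (C : eqType) (D : seq C) k : (0 < size D)%N -> uniq D ->
  avg D k (fun l => (~~ uniq l)%:R) <= k%:R ^+ 2 / (size D)%:R.
Proof.
move=> D0 uD; elim: k => [|k IH]; first by rewrite /= expr0n mul0r.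
rewrite avgS.
have: \sum_(x <- D) avg D k (fun l => (~~ uniq (x :: l))%:R) <=
      \sum_(x <- D) (k%:R / (size D)%:R + k%:R ^+ 2 / (size D)%:R) :> K.
  rewrite big_seq [leRHS]big_seq; apply: ler_sum => x xD.
  have h : avg D k (fun l => (has (pred1 x) l)%:R) <= k%:R / (size D)%:R.
    have := avg_hit (pred1 x) k D0.
    by rewrite (count_uniq_mem x uD) xD mulr1.
  apply: le_trans (_ : _ <= _) (lerD h IH); rewrite -avgD; apply: avg_le => l _ _.
  rewrite -natrD ler_nat /= has_pred1.
  by case: (x \in l); case: (uniq l).
rewrite big_const_seq iter_addr_0 count_predT -[_ *+ size D]mulr_natr => h.
rewrite ler_pdivrMr ?ltr0n //; apply: le_trans h _.
rewrite ler_wpM2r // -mulrDl ler_wpM2r ?invr_ge0 //.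
by rewrite -natrX -natrX -natrD ler_nat; nia.
Qed.

(** The event [F] is split only among the good colours, so the popular colour that is found is good
    as well. Its density depends on the number of colours but not on [D]. *)
Lemma avg_pigeonhole (C : eqType) (D : seq C) k (Q : finType)
    (col : seq C -> Q) (good : pred Q) (F : pred (seq C)) (c : K) :
  0 < c ->
  (forall l, size l = k -> {subset l <= D} -> F l -> good (col l)) ->
  c <= avg D k (fun l => (F l)%:R) ->
  exists2 q, good q & c / #|Q|%:R <= avg D k (fun l => (col l == q)%:R).
Proof.
move=> c0 Fg cF.
have cs : c <= \sum_(q | good q) avg D k (fun l => (col l == q)%:R).
  apply: (le_trans cF); rewrite -avg_sum; apply: avg_le => l sl lD.
  have [Fl|_] := boolP (F l); last by apply: sumr_ge0.
  by rewrite (bigD1 (col l)) ?Fg //= eqxx lerDl sumr_ge0.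
have [q gq|nq] := pickP (fun q => good q && (c / #|Q|%:R <= avg D k (fun l => (col l == q)%:R))).
  by case/andP: gq => ? ?; exists q.
have Q0 : (0 < #|Q|)%N.
  rewrite lt0n; apply/eqP => Q0; suff: c <= 0 by rewrite leNgt c0.
  apply: (le_trans cs); rewrite big_pred0 // => q.
  by have := fintype0 q Q0.
suff: \sum_(q | good q) avg D k (fun l => (col l == q)%:R) < c.
  by rewrite ltNge cs.
have [q0 gq0|ng] := pickP good; last by rewrite big_pred0.
apply: lt_le_trans (_ : \sum_(q | good q) c / #|Q|%:R <= _).
  apply: ltr_sum; first by apply/hasP; exists q0; rewrite ?mem_index_enum.
  by move=> q gq; have := nq q; rewrite gq /= => /negbT; rewrite ltNge.
rewrite sumr_const -[c / _ *+ _]mulr_natr -mulrA ger_pMr // mulrC.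
rewrite ler_pdivrMr ?ltr0n // mul1r ler_nat.
exact: max_card.
Qed.

End Average.

(** * Counting blow-ups *)

Section BlowUpCount.
Variables (K : realFieldType) (C : eqType) (D : seq C).

(** The expectation over a random family of parts, with one list of [b] independent draws for each
    [b] in [bs]. *)
Fixpoint avgB (bs : seq nat) (G : seq (seq C) -> K) : K :=
  if bs is b :: bs' then avg D b (fun t => avgB bs' (fun ts => G (t :: ts)))
  else G [::].

(* Vacuously true when some part of [ts] is empty. *)
Fixpoint transversals (F : pred (seq C)) (ts : seq (seq C)) : bool :=
  if ts is t :: ts' then all (fun x => transversals (fun l => F (x :: l)) ts') t
  else F [::].

Lemma transversalsP (F : pred (seq C)) x0 ts l : transversals F ts ->
  size l = size ts ->
  (forall j, (j < size ts)%N -> nth x0 l j \in nth [::] ts j) -> F l.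
Proof.
elim: ts F l => [|t ts IH] F [|x l] //= /allP Ft [sl] lts.
apply: (IH (fun l => F (x :: l))) => // [|j jts]; last exact: (lts j.+1).
exact: Ft (lts 0%N isT).
Qed.

Lemma transversals_all (I : eqType) (s : seq I) (F : I -> pred (seq C)) ts :
  transversals (fun l => all (fun i => F i l) s) ts =
  all (fun i => transversals (F i) ts) s.
Proof.
elim: ts F => [|t ts IH] F //=.
under eq_all do rewrite IH.
by apply/allP/allP => h i iin; apply/allP => j jin;
  move/allP: (h j jin); apply.
Qed.

Lemma avgB_le bs G G' :
  (forall ts, map size ts = bs -> (forall t, t \in ts -> {subset t <= D}) ->
     G ts <= G' ts) -> avgB bs G <= avgB bs G'.
Proof.
elim: bs G G' => [|b bs IH] G G' GG' /=; first exact: GG'.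
apply: avg_le => t st tD; apply: IH => ts sts tsD; apply: GG' => /=.
  by rewrite st sts.
by move=> t'; rewrite inE => /predU1P[->|/tsD].
Qed.

Lemma avgB_flatten bs G :
  avgB bs (fun ts => G (flatten ts)) = avg D (sumn bs) G.
Proof.
elim: bs G => [|b bs IH] G //=; rewrite avg_cat.
by apply: eq_avg => t _ _; rewrite -IH.
Qed.

Lemma avgB_exists bs G c : (0 < size D)%N -> c <= avgB bs G ->
  exists ts, [/\ map size ts = bs, forall t, t \in ts -> {subset t <= D}
                & c <= G ts].
Proof.
move=> D0; elim: bs G => [|b bs IH] G /=; first by exists [::].
move=> /(avg_exists D0)[t [st tD /IH[ts [sts tsD cG]]]].
exists (t :: ts); split => //=; first by rewrite st sts.
by move=> t'; rewrite inE => /predU1P[->|/tsD].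
Qed.

(* Jensen's inequality, one coordinate at a time: intersecting over the [b]
   choices of a coordinate turns its density [d] into at least [d ^+ b]. *)
Lemma avg_blowup bs (F : pred (seq C)) : (0 < size D)%N ->
  avg D (size bs) (fun l => (F l)%:R) ^+ (\prod_(b <- bs) b) <=
  avgB bs (fun ts => (transversals F ts)%:R).
Proof.
move=> D0; elim: bs F => [|b bs IH] F /=; first by rewrite big_nil expr1.
pose Ft t l := all (fun x => F (x :: l)) t.
rewrite big_cons exprM; set d := (\sum_(x <- D) _) / _.
apply: le_trans (_ : avg D b (fun t =>
   avg D (size bs) (fun l => (Ft t l)%:R)) ^+ (\prod_(b <- bs) b) <= _); last first.
  apply: (le_trans (avg_jensen D0 _ _)) => [t _ _|]; first exact: avg_ge0.
  apply: avg_le => t _ _; apply: le_trans (IH _) _.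
  by apply: avgB_le => ts _ _; rewrite transversals_all.
have d0 : 0 <= d.
  by rewrite mulr_ge0 ?invr_ge0 // sumr_ge0 // => x _; apply: avg_ge0.
rewrite lerXn2r ?nnegrE ?exprn_ge0 //.
  by apply: avg_ge0 => *; apply: avg_ge0.
rewrite avg_exchange.
have -> : d = avg D (size bs)
    (fun l => (\sum_(x <- D) (F (x :: l))%:R) / (size D)%:R).
  rewrite /d mulrC -avg_sum -avgZ; apply: eq_avg => l _ _; exact: mulrC.
apply: (le_trans (avg_jensen D0 _ _)) => [t _ _|].
  by rewrite mulr_ge0 ?invr_ge0 // sumr_ge0.
apply: avg_le => l _ _; rewrite -avg_prod //; apply: avg_le => t _ _.
rewrite /Ft; elim: t => [|x t IHt] /=; first by rewrite big_nil.
by rewrite big_cons; case: (F _); rewrite /= ?mul1r ?mul0r.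
Qed.

End BlowUpCount.

(** * Property graphs seen through random lists *)

Section UniqLists.
Variables (K : realFieldType) (T : finType).

(** Exactly [#|S|!] lists enumerate [S]: the head is any [x] in [S] and the tail enumerates
    [S :\ x]. *)
Lemma sum_lists_of_set (D : seq T) (S : {set T}) : uniq D -> {subset S <= D} ->
  avg D #|S| (fun l => (uniq l && ([set x in l] == S))%:R) =
  (#|S|`!)%:R / (size D)%:R ^+ #|S| :> K.
Proof.
move=> uD; move eqk: #|S| => k; elim: k S eqk => [|k IH] S cS SD.
  rewrite /= expr0 divr1; move/eqP: cS; rewrite cards_eq0 => /eqP ->.
  by rewrite (_ : [set x in [::]] = set0) ?eqxx //; apply/setP => x; rewrite !inE.
rewrite avgS exprS invfM mulrCA -[RHS]mulrC; congr (_ / _).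
rewrite (eq_bigr (fun x => if x \in S then (k`!)%:R / (size D)%:R ^+ k else 0)).
  rewrite -big_mkcond /= -big_filter.
  have pe : perm_eq [seq x <- D | x \in S] (enum S).
    apply: uniq_perm => [||x]; [exact: filter_uniq | exact: enum_uniq |].
    by rewrite mem_filter mem_enum; case: (boolP (x \in S)) => // /SD ->.
  rewrite (perm_big _ pe) /= big_const_seq iter_addr_0 count_predT -cardE cS -[_ *+ _]mulr_natr.
  by rewrite factS natrM mulrC mulrA.
move=> x _; case: ifPn => xS; last first.
  rewrite -[RHS](avg0 _ D k); apply: eq_avg => l _ _ /=.
  case: eqP => [eS|]; last by rewrite andbF.
  by move: xS; rewrite -eS !inE eqxx.
rewrite -(IH (S :\ x)); first last.
- by move=> y; rewrite !inE => /andP[_ /SD].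
- by have := cardsD1 x S; rewrite xS cS => -[].
apply: eq_avg => l _ _ /=; congr (nat_of_bool _)%:R.
apply/andP/andP => -[].
  move=> /andP[xl ->] /eqP eS; split=> //; apply/eqP/setP => y; rewrite -eS !inE.
  by case: eqVneq => [->|] //=; exact/negbTE.
move=> -> /eqP /setP eS; split.
  by rewrite andbT; apply/negP => xl; have := eS x; rewrite !inE eqxx xl.
apply/eqP/setP => y; have := eS y; rewrite !inE.
by case: eqVneq => [->|] //= _.
Qed.

End UniqLists.

Section Robust.
Variables (K : realType) (m : nat) (T : finType) (H : mdigraph m T).

Definition in_property_graph t (P : mdigraph m T -> Prop) (l : seq T) : bool :=
  uniq l && ([set x in l] \in property_graph t H P).

Lemma in_property_graphP t P l : in_property_graph t P l ->
  [/\ uniq l, {subset l <= verts H}, size l = t & P (induced H [set x in l])].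
Proof.
move=> /andP[ul]; rewrite inE => /and3P[/subsetP lH /eqP cl /asboolP Pl].
split=> //; first by move=> x xl; apply: lH; rewrite inE.
by rewrite -cl cardsE; apply/esym/card_uniqP.
Qed.

(** Robustness counts sets, whereas the averages draw lists with repetition. The conversion costs
    the ratio of the falling factorial of [n - 1] to the power [n ^ (t - 1)], which is at least
    [1 - t ^ 2 / n]. *)
Lemma robustly_avg t P v (D : seq T) : (0 < t)%N -> robustly K t P H ->
  perm_eq D (enum (verts H)) -> v \in verts H ->
  1 - (t%:R ^+ 2)^-1 - t%:R ^+ 2 / #|verts H|%:R <=
  avg D t.-1 (fun l => (in_property_graph t P (v :: l))%:R) :> K.
Proof.
move=> t0 rob pD vH; set n := #|verts H|; set PG := property_graph t H P.
have uD : uniq D by rewrite (perm_uniq pD) enum_uniq.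
have sD : size D = n by rewrite (perm_size pD) -cardE.
have n0 : (0 < n)%N by apply/card_gt0P; exists v.
(* With fewer than [t] vertices the error term alone is at least 1, and the bound is trivial. *)
have [nt|tn] := ltnP n t.
  apply: le_trans (_ : 0 <= _); last exact: avg_ge0.
  have n0' : 0 < n%:R :> K by rewrite ltr0n.
  have : 0 <= (t%:R ^+ 2)^-1 :> K by rewrite invr_ge0 exprn_ge0.
  have : 1 <= t%:R ^+ 2 / n%:R :> K.
    rewrite ler_pdivlMr // mul1r -natrX ler_nat; nia.
  lra.
have := rob v vH; rewrite -/PG -/n; set d := #|[set S in PG | v \in S]| => dle.
have -> : avg D t.-1 (fun l => (in_property_graph t P (v :: l))%:R) =
   d%:R * ((t.-1)`!%:R / n%:R ^+ t.-1) :> K.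
  rewrite (eq_avg (G := fun l => \sum_(S in [set S in PG | v \in S])
     (uniq l && ([set x in l] == S :\ v))%:R)).
    rewrite avg_sum (eq_bigr (fun=> (t.-1)`!%:R / n%:R ^+ t.-1)).
      by rewrite sumr_const -[X in X = _]mulr_natl.
    move=> S; rewrite !inE => /andP[/and3P[/subsetP SH /eqP cS _] vS].
    have cSv : #|S :\ v| = t.-1 by have := cardsD1 v S; rewrite vS cS => ->.
    rewrite -{1}cSv sum_lists_of_set ?cSv ?sD // => x; rewrite !inE => /andP[_ xS].
    by rewrite (perm_mem pD) mem_enum SH.
  move=> l sl lD; rewrite /in_property_graph /=.
  have [vl|vl] := boolP (v \in l).
    rewrite /= big1 // => S _; case: eqP => [eS|]; last by rewrite andbF.
    by have : v \in S :\ v; [rewrite -eS inE | rewrite !inE eqxx].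
  have ev : [set x in v :: l] :\ v = [set x in l].
    by apply/setP => y; rewrite !inE; case: eqVneq => // ->; rewrite (negbTE vl).
  have [lP|lP] := boolP ([set x in v :: l] \in PG); last first.
    rewrite /= andbF big1 // => S; rewrite inE => /andP[SP vS].
    case: eqP => [eS|]; last by rewrite andbF.
    suff eS' : [set x in v :: l] = S by rewrite eS' SP in lP.
    by rewrite -(setD1K vS) -eS; apply/setP => y; rewrite !inE.
  rewrite (bigD1 [set x in v :: l]) /=; last by rewrite inE lP !inE eqxx.
  rewrite ev eqxx !andbT big1 ?addr0 // => S /andP[]; rewrite inE => /andP[SP vS] nS.
  case: eqP => [eS|]; last by rewrite andbF.
  by case/eqP: nS; rewrite -(setD1K vS) -eS; apply/setP => y; rewrite !inE.
have n0' : 0 < n%:R :> K by rewrite ltr0n.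
have fn : 0 <= (t.-1)`!%:R / n%:R ^+ t.-1 :> K by rewrite mulr_ge0 ?invr_ge0 ?exprn_ge0.
apply: le_trans (ler_wpM2r fn dle); rewrite -[leRHS]mulrA.
have [a0 a1] : 0 <= (1 - 1 / t%:R ^+ 2 : K) /\ (1 - 1 / t%:R ^+ 2 : K) <= 1.
  have t2 : 1 <= t%:R ^+ 2 :> K by rewrite -natrX ler1n expn_gt0 t0.
  have tp : 0 < t%:R ^+ 2 :> K by lra.
  split; first by rewrite subr_ge0 ler_pdivrMr // mul1r.
  by rewrite gerBl divr_ge0 ?exprn_ge0.
suff h : 1 - t%:R ^+ 2 / n%:R <=
    'C(n - 1, t - 1)%:R * ((t.-1)`!%:R / n%:R ^+ t.-1) :> K.
  apply: le_trans (ler_wpM2l a0 h); rewrite div1r mulrBr mulr1.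
  rewrite div1r in a1 a0; rewrite lerB // ler_piMl //.
  by rewrite divr_ge0 ?exprn_ge0.
rewrite mulrA -natrM !subn1 bin_ffact ler_pdivlMr ?exprn_gt0 //.
have tn' : t%:R / n%:R <= 1 :> K by rewrite ler_pdivrMr // mul1r ler_nat.
have tn0 : 0 <= t%:R / n%:R :> K by rewrite divr_ge0.
(* Every factor of the falling factorial is at least [n - t], so it suffices to bound
   [(1 - t / n) ^ (t - 1)] by Bernoulli's inequality. *)
have b1 := bernoulli_pow t.-1 (introT andP (conj tn0 tn')).
apply: le_trans (_ : (1 - t%:R / n%:R) ^+ t.-1 * n%:R ^+ t.-1 <= _).
  rewrite ler_wpM2r ?exprn_ge0 //; apply: le_trans b1.
  rewrite lerD2l lerN2 mulrA ler_wpM2r ?invr_ge0 // -natrM -natrX ler_nat; nia.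
rewrite -exprMn mulrBl mul1r mulfVK ?gt_eqF // -natrB // -natrX ler_nat.
move: tn t0; clear; case: t => // t tn _ /=.
have : (forall j, j <= t -> (n - t.+1) ^ j <= n.-1 ^_ j)%N; last exact.
elim=> [|j IH] jt; first by rewrite ffactn0.
by rewrite ffactnSr expnSr leq_mul ?IH ?(ltnW jt) //; lia.
Qed.

End Robust.

(** * Matchings in fissile digraphs *)

Section Multiplicity.
Variables (m : nat) (T : finType).

Lemma mult_count (v : T) (e : m.-tuple T) : mult v e = count_mem v e.
Proof.
rewrite /mult cardsE cardE /enum_mem size_filter -[in RHS](map_tnth_enum e) count_map.
by rewrite -enumT.
Qed.

Lemma mult_notin (v : T) (e : m.-tuple T) : v \notin e -> mult v e = 0%N.
Proof. by move=> ve; rewrite mult_count; exact: count_memPn. Qed.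

Lemma sum_mult (e : m.-tuple T) : (\sum_v mult v e = m)%N.
Proof.
under eq_bigr do rewrite /mult -sum1_card big_mkcond /=.
rewrite exchange_big /= (eq_bigr (fun=> 1%N)) ?sum1_card ?card_ord // => i _.
rewrite (bigD1 (tnth e i)) //= inE eqxx big1 ?addn0 // => v nv.
by rewrite inE eq_sym (negbTE nv).
Qed.

End Multiplicity.

Section Matchable.
Variables (m : nat) (T : finType) (H : mdigraph m T).

Definition matchable (S : {set T}) : Prop :=
  exists es : seq (m.-tuple T),
    [/\ {subset es <= edges H}, uniq (flatten (map val es))
      & S = [set x in flatten (map val es)]].

Lemma matchable0 : matchable set0.
Proof. by exists [::]; split=> //; apply/setP => x; rewrite !inE. Qed.

Lemma matchableU S S' : matchable S -> matchable S' -> [disjoint S & S'] ->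
  matchable (S :|: S').
Proof.
move=> [es [eH ue ->]] [fs [fH uf ->]] dSS; exists (es ++ fs).
rewrite map_cat flatten_cat cat_uniq ue uf andbT; split.
- by move=> e; rewrite mem_cat => /orP[/eH|/fH].
- apply/hasPn => x xf; apply/negP => xe; move/pred0P: dSS => /(_ x) /=.
  by rewrite !inE xf xe.
- by apply/setP => x; rewrite !inE mem_cat.
Qed.

Lemma matchable_edge (e : m.-tuple T) :
  e \in edges H -> uniq e -> matchable [set x in e].
Proof.
move=> eH ue; exists [:: e]; rewrite /= cats0; split=> //.
by move=> f; rewrite inE => /eqP ->.
Qed.

Lemma matchable_perfect : (0 < m)%N -> matchable (verts H) -> has_perfect_matching H.
Proof.
move=> m0 [es [eH ue vE]]; exists [set e in es]; split; first split.
- by apply/subsetP => e; rewrite inE => /eH.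
- move=> e; rewrite inE => /(map_f val)/splitPr => h.
  by case: h ue => s1 s2; rewrite flatten_cat /= !cat_uniq => /and3P[_ _ /and3P[]].
- move=> e f; rewrite !inE => ein fin nef v; apply/negP => /andP[ve vf].
  elim: es ue ein fin {eH vE} => // g es IH /=; rewrite cat_uniq => /and3P[_ hg ues].
  have hh (x : m.-tuple T) : x \in es -> v \in x -> v \in g -> False.
    move=> xes vx vg; case/hasP: hg; exists v => //.
    by apply/flattenP; exists (val x) => //; exact: map_f.
  rewrite !inE => /predU1P[eg|ein] /predU1P[fg|fin].
  + by rewrite eg fg eqxx in nef.
  + by apply: (hh f) => //; rewrite -eg.
  + by apply: (hh e) => //; rewrite -fg.
  + exact: IH.
- move=> v; rewrite vE inE => /flattenP[s /mapP[e ein ->] ve].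
  by exists e; rewrite ?inE.
Qed.

Lemma matchable_sub S : matchable S -> S \subset verts H.
Proof.
move=> [es [eH _ ->]]; apply/subsetP => x; rewrite inE => /flattenP[s].
by case/mapP => e /eH eE -> /tnthP[i ->]; exact: edges_verts eE i.
Qed.

Lemma size_flatten_tuples (es : seq (m.-tuple T)) :
  size (flatten (map val es)) = (m * size es)%N.
Proof.
rewrite size_flatten /shape -map_comp; elim: es => [|e es IH] /=; first by rewrite muln0.
by rewrite IH size_tuple mulnS.
Qed.

Section Fissile.
Hypothesis fH : fissile H.

(** Fissility applied to the digraph whose only edge is [f], so only the parts at vertices of [f]
    matter. *)
Lemma fissile_edge (U : finType) (V : U -> {set T}) (f : m.-tuple U) :
  (0 < m)%N ->
  (forall u, u \in f -> V u \subset verts H) ->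
  (forall u v, u \in f -> v \in f -> u != v -> [disjoint V u & V v]) ->
  (forall e, strictly_preserving V f e -> e \in edges H) ->
  (forall u, u \in f -> mult u f <= #|V u|)%N ->
  exists e, [/\ e \in edges H, preserving V f e & uniq e].
Proof.
move=> m0 VH dV Ve mV.
have Rproof : forall e, e \in [set f] -> forall i, tnth e i \in [set x in f].
  by move=> e; rewrite inE => /eqP -> i; rewrite inE mem_tnth.
apply: (fH (R := MDigraph Rproof) (V := V)); rewrite /= ?inE //.
- split=> /= [x|x y]; rewrite !inE; last exact: dV.
  move=> xf; rewrite -card_gt0; apply: leq_trans (mV x xf).
  by rewrite mult_count -has_count has_pred1.
- split; first by apply/bigcupsP => x; rewrite inE; exact: VH.
  by apply/subsetP => e; rewrite inE => /existsP[g]; rewrite /= !inE => /andP[/eqP ->]; exact: Ve.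
- by apply/forallP => i; apply: mV; exact: mem_tnth.
Qed.

(** The edges of [fs] are realised one at a time: fissility gives an injective edge of [H] with the
    part profile of [f], its vertices are deleted from the parts, and the smaller parts still
    satisfy the hypotheses for the remaining edges. *)
Lemma matchable_blowup (U : finType) (V : U -> {set T}) (fs : seq (m.-tuple U)) :
  (0 < m)%N ->
  (forall u, V u \subset verts H) ->
  (forall u v, u != v -> [disjoint V u & V v]) ->
  (forall f, f \in fs -> forall e, strictly_preserving V f e -> e \in edges H) ->
  (forall u, \sum_(f <- fs) mult u f = #|V u|)%N ->
  matchable (\bigcup_u V u).
Proof.
move=> m0; elim: fs V => [|f fs IH] V VH dV Ve mV.
  rewrite big1 => [|u _]; first exact: matchable0.
  by apply/eqP; rewrite -cards_eq0 -mV big_nil.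
have [||||e [eH pe ue]] := @fissile_edge _ V f m0.
- by move=> u _; exact: VH.
- by move=> u v _ _; exact: dV.
- by apply: Ve; rewrite inE eqxx.
- by move=> u _; rewrite -mV big_cons leq_addr.
have eV i u : (tnth e i \in V u) = (tnth f i == u).
  have ei : tnth e i \in V (tnth f i) by exact: (forallP pe).
  have [<-//|nu] := eqVneq; apply/negP => eu.
  by have /pred0P/(_ (tnth e i)) := dV _ _ nu; rewrite /= ei eu.
pose V' u := V u :\: [set x in e].
have V'V u : V' u \subset V u by exact: subsetDl.
have -> : \bigcup_u V u = [set x in e] :|: \bigcup_u V' u.
  apply/setP => x; rewrite !inE; apply/bigcupP/orP => [[u _ xV]|].
    have [xe|xe] := boolP (x \in e); first by left.
    by right; apply/bigcupP; exists u; rewrite // !inE xe.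
  case=> [/tnthP[i ->]|/bigcupP[u _ xV]]; last by exists u; rewrite // (subsetP (V'V u)).
  by exists (tnth f i); rewrite ?eV.
apply: matchableU; first exact: matchable_edge.
- apply: IH => [u|u v nuv|g gfs e' /andP[pe' se']|u].
  + exact: subset_trans (V'V u) (VH u).
  + apply: disjointWl (V'V u) _; apply: disjointWr (V'V v) _; exact: dV.
  + apply: (Ve g); rewrite ?inE ?gfs ?orbT //; apply/andP; split=> //.
    by apply/forallP => i; apply: (subsetP (V'V _)); exact: (forallP pe').
  (* As [e] is injective and the parts are disjoint, [e] removes exactly [mult u f] vertices from
     part [u], so the degree count stays exact. *)
  + have := mV u; rewrite big_cons -(cardsID [set x in e] (V u)).
    suff -> : #|V u :&: [set x in e]| = mult u f by move/addnI.
    have -> : V u :&: [set x in e] = [set tnth e i | i in [set i | tnth f i == u]].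
      apply/setP => x; rewrite !inE; apply/andP/imsetP => [[xV /tnthP[i xi]]|[i]].
        by exists i; rewrite // inE -eV -xi.
      by rewrite inE => fi ->; rewrite eV fi mem_tnth.
    rewrite card_imset // => i j /eqP; rewrite (tnth_nth (tnth e i)).
    by rewrite [tnth e j](tnth_nth (tnth e i)) nth_uniq ?size_tuple // => /eqP/val_inj.
- rewrite disjoint_sym; apply/pred0P => x; rewrite /= inE.
  by apply/negP => /andP[/bigcupP[u _]]; rewrite !inE => /andP[/negP].
Qed.

End Fissile.
End Matchable.

Section MatchingsFromPatterns.
Variables (m : nat) (T : finType) (H : mdigraph m T).
Hypotheses (fH : fissile H) (m0 : (0 < m)%N).

Lemma subset_of_card (A : {set T}) k : (k <= #|A|)%N ->
  exists2 B : {set T}, B \subset A & #|B| = k.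
Proof.
move=> kA; have := card_uniqP (take_uniq k (enum_uniq A)).
rewrite size_take_min -cardE (minn_idPl kA) => cB.
exists [set x in take k (enum A)]; last by rewrite cardsE.
by apply/subsetP => x; rewrite inE => /mem_take; rewrite mem_enum.
Qed.

(** Each part is cut down to exactly the degree of its vertex; strictly preserving tuples of smaller
    parts are still edges. *)
Lemma matchable_blowup_le (U : finType) (V : U -> {set T}) (fs : seq (m.-tuple U)) :
  (forall u, V u \subset verts H) ->
  (forall u v, u != v -> [disjoint V u & V v]) ->
  (forall f, f \in fs -> forall e, strictly_preserving V f e -> e \in edges H) ->
  (forall u, \sum_(f <- fs) mult u f <= #|V u|)%N ->
  exists S, [/\ matchable H S, S \subset \bigcup_u V u & #|S| = (m * size fs)%N].
Proof.
move=> VH dV Ve mV.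
have /choice[W hW] u : exists B : {set T}, B \subset V u /\ #|B| = (\sum_(f <- fs) mult u f)%N.
  by have [B ? ?] := subset_of_card (mV u); exists B.
have dW u v : u != v -> [disjoint W u & W v].
  move=> /dV d; apply: disjointWl (hW u).1 _; exact: disjointWr (hW v).1 _.
exists (\bigcup_u W u); split.
- apply: (matchable_blowup fH (fs := fs)) => // [u|f ffs e /andP[pe se]|u].
  + exact: subset_trans (hW u).1 (VH u).
  + apply: (Ve f) => //; apply/andP; split=> //; apply/forallP => i.
    by apply: (subsetP (hW _).1); exact: (forallP pe).
  + by rewrite (hW u).2.
- by apply/bigcupsP => u _; apply: subset_trans (hW u).1 _; exact: bigcup_sup.
- transitivity (\sum_u #|W u|)%N.
    rewrite -sum1_card partition_disjoint_bigcup //.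
    by apply: eq_bigr => u _; rewrite sum1_card.
  rewrite (eq_bigr _ (fun u _ => (hW u).2)) exchange_big /=.
  under eq_bigr do rewrite sum_mult.
  by rewrite big_const_seq iter_addn_0 count_predT.
Qed.

Lemma uniq_flatten_inj (es : seq (m.-tuple T)) (e f : m.-tuple T) i j :
  uniq (flatten (map val es)) -> e \in es -> f \in es -> tnth e i = tnth f j ->
  e = f /\ i = j.
Proof.
move=> ue ein fin eij; have ef : e = f.
  have : tnth e i \in f by rewrite eij mem_tnth.
  have : tnth e i \in e by exact: mem_tnth.
  move: (tnth e i) => v ve vf {i j eij}.
  elim: es ue ein fin => // g es IH /=; rewrite cat_uniq => /and3P[_ hg ues].
  have hh (x : m.-tuple T) : x \in es -> v \in x -> v \in g -> False.
    move=> xes vx vg; case/hasP: hg; exists v => //.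
    by apply/flattenP; exists (val x) => //; exact: map_f.
  rewrite !inE => /predU1P[eg|ein] /predU1P[fg|fin]; first by rewrite eg fg.
  - by case: (hh f fin vf); rewrite -eg.
  - by case: (hh e ein ve); rewrite -fg.
  - exact: IH.
split=> //; move: eij; rewrite ef in ein * => /eqP.
rewrite (tnth_nth (tnth f i)) [tnth f j](tnth_nth (tnth f i)) nth_uniq ?size_tuple //.
  by move=> /eqP/val_inj.
move: ein => /(map_f val)/splitPr h; case: h ue => s1 s2.
by rewrite flatten_cat /= !cat_uniq => /and3P[_ _ /and3P[]].
Qed.

End MatchingsFromPatterns.

Lemma tuples_of_seq (T : Type) m k (l : seq T) : size l = (k * m)%N ->
  exists2 us : seq (m.-tuple T), flatten (map val us) = l & size us = k.
Proof.
elim: k l => [|k IH] l sl; first by exists [::] => //; apply/esym/size0nil.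
have st : size (take m l) == m by rewrite size_takel // sl mulSn leq_addr.
have sd : size (drop m l) = (k * m)%N by rewrite size_drop sl mulSn addKn.
have [us eus sus] := IH _ sd.
by exists (Tuple st :: us); rewrite /= ?eus ?cat_take_drop ?sus.
Qed.

(** * Sampling by columns and transporting fractional matchings *)

Section Columns.
Variables (K : realFieldType) (m : nat) (T : finType).

Definition entries (cs : seq (m.-tuple T)) (js : seq 'I_m) : seq T :=
  [seq tnth p.1 p.2 | p <- zip cs js].

(** All columns have length [m], so a uniform column followed by a uniform row is a uniform vertex.
    This carries the robust degree condition from vertices over to columns. *)
Lemma avg_entries (D : seq (m.-tuple T)) k (F : seq T -> K) :
  avg D k (fun cs => avg (enum 'I_m) k (fun js => F (entries cs js))) =
  avg (flatten (map val D)) k F.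
Proof.
elim: k F => [|k IH] F //; set V := flatten _ in IH *.
have sV : size V = (m * size D)%N.
  exact: size_flatten_tuples.
have h c : avg D k (fun cs => avg (enum 'I_m) k.+1
      (fun js => F (entries (c :: cs) js))) =
    (\sum_(i < m) avg V k (fun l => F (tnth c i :: l))) / m%:R.
  transitivity (avg D k (fun cs => (m%:R)^-1 * \sum_(i <- enum 'I_m)
      avg (enum 'I_m) k (fun js => F (tnth c i :: entries cs js)))).
    by apply: eq_avg => cs _ _; rewrite avgS size_enum_ord mulrC.
  rewrite avgZ avg_sum big_enum mulrC /=; congr (_ / _).
  by apply: eq_bigr => i _; rewrite -IH.
rewrite [LHS]avgS [RHS]avgS sV natrM invfM mulrA; congr (_ / _).
rewrite (eq_bigr _ (fun c _ => h c)) -mulr_suml; congr (_ / _).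
rewrite [RHS]big_flatten big_map; apply: eq_bigr => c _.
by rewrite big_tuple.
Qed.

End Columns.

Section Push.
Variables (K : realType) (m : nat) (T Z : finType) (H : mdigraph m T).

(** Weights are summed over the fibres of [e |-> map idx e]. The load at [z] is bounded by 0 unless
    [z] is the index of a point of [S]; averaging over row choices relies on this sharp form. *)
Lemma fractional_push (S : seq T) (idx : T -> Z) (vl : Z -> T)
    (R : {set m.-tuple Z}) (w : m.-tuple T -> K) :
  (forall x, x \in S -> vl (idx x) = x) ->
  is_fractional_matching (induced H [set x in S]) w ->
  (forall e, e \in edges (induced H [set x in S]) -> [tuple of map idx e] \in R) ->
  exists om : m.-tuple Z -> K,
    [/\ forall f, 0 <= om f,
        forall z, \sum_(f in R) om f * (mult z f)%:R <=
                  ((vl z \in S) && (idx (vl z) == z))%:R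
      & \sum_(f in R) om f = \sum_(e in edges (induced H [set x in S])) w e].
Proof.
set E := edges _ => vlK [w01 w1] ER.
exists (fun f => \sum_(e in E | [tuple of map idx e] == f) w e); split.
- by move=> f; apply: sumr_ge0 => e /andP[/w01/andP[]].
- move=> z; have -> : \sum_(f in R) (\sum_(e in E | [tuple of map idx e] == f) w e) *
     (mult z f)%:R = \sum_(e in E) w e * (mult z [tuple of map idx e])%:R.
    rewrite [RHS](partition_big (fun e : m.-tuple T => [tuple of map idx e]) (mem R)) //.
    apply: eq_bigr => f _; rewrite mulr_suml.
    by apply: eq_bigr => e /andP[_ /eqP ->].
  have mE e : e \in E -> mult z [tuple of map idx e] =
     (if (vl z \in S) && (idx (vl z) == z) then mult (vl z) e else 0)%N.
    rewrite /E inE => /andP[_ /forallP eS]; rewrite !mult_count count_map.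
    have xS x : x \in e -> x \in S by move=> /tnthP[i ->]; have := eS i; rewrite inE.
    case: ifPn => [/andP[zS /eqP iz]|nz].
      apply: eq_in_count => x /xS xS' /=; apply/eqP/eqP => [<-|->//].
      by rewrite vlK.
    apply/eqP; rewrite -leqn0 leqNgt -has_count; apply/hasPn => x /xS xS' /=.
    by apply: contra nz => /eqP <-; rewrite vlK // xS' eqxx.
  rewrite (eq_bigr (fun e => w e * (if (vl z \in S) && (idx (vl z) == z)
     then mult (vl z) e else 0)%:R)); last by move=> e eE; rewrite mE.
  have [/andP[zS iz]|_] := boolP ((vl z \in S) && (idx (vl z) == z)); last first.
    by rewrite big1 // => e _; rewrite mulr0.
  by apply: w1; rewrite inE.
- by rewrite [RHS](partition_big (fun e : m.-tuple T => [tuple of map idx e]) (mem R)).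
Qed.

End Push.

(** * Covering most vertices *)

Section ExistsBlowup.
Variables (K : realFieldType) (C : eqType) (D : seq C).

Lemma avg_count (B : pred C) k : (0 < size D)%N ->
  avg D k (fun l => (count B l)%:R) = k%:R * (count B D)%:R / (size D)%:R :> K.
Proof.
move=> D0; elim: k => [|k IH]; first by rewrite /= !mul0r.
have cB : (count B D)%:R = \sum_(x <- D) (B x)%:R :> K.
  by rewrite -sum1_count natr_sum big_mkcond; apply: eq_bigr => x _; case: (B x).
rewrite avgS; under eq_bigr do under eq_avg do rewrite /= natrD.
under eq_bigr do rewrite avgD avg_const // IH.
have sD0 : (size D)%:R != 0 :> K by rewrite pnatr_eq0 -lt0n.
rewrite big_split /= -cB big_const_seq iter_addr_0 count_predT.
rewrite -[_ *+ size D]mulr_natr mulfVK // -natr1; congr (_ / _); ring.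
Qed.

Lemma avgBD bs (G G' : seq (seq C) -> K) :
  avgB D bs (fun ts => G ts + G' ts) = avgB D bs G + avgB D bs G'.
Proof.
elim: bs G G' => [|b bs IH] G G' //=; rewrite -avgD.
by apply: eq_avg => t _ _; rewrite IH.
Qed.

(** By [avg_blowup] complete families of parts have a density bounded below, while families with a
    repeated entry have density [O(1 / |D|)]. For large [D] some complete family has no
    repetition. *)
Lemma exists_blowup bs (F : pred (seq C)) (d : K) : (0 < size D)%N -> uniq D ->
  0 <= d <= avg D (size bs) (fun l => (F l)%:R) ->
  (sumn bs)%:R ^+ 2 / (size D)%:R < d ^+ (\prod_(b <- bs) b) ->
  exists ts, [/\ map size ts = bs, forall t, t \in ts -> {subset t <= D},
                 transversals F ts & uniq (flatten ts)].
Proof.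
move=> D0 uD /andP[d0 dF] small.
pose G ts := (transversals F ts && uniq (flatten ts))%:R : K.
have h : d ^+ (\prod_(b <- bs) b) <= avgB D bs G + (sumn bs)%:R ^+ 2 / (size D)%:R.
  apply: le_trans (_ : avg D (size bs) (fun l => (F l)%:R) ^+ (\prod_(b <- bs) b) <= _).
    by rewrite lerXn2r ?nnegrE // (le_trans d0).
  apply: (le_trans (avg_blowup _ _ _ D0)).
  apply: le_trans (_ : _ <= avgB D bs G + avg D (sumn bs) (fun l => (~~ uniq l)%:R)) _.
    rewrite -avgB_flatten -avgBD; apply: avgB_le => ts _ _; rewrite /G.
    rewrite -natrD ler_nat; by case: (transversals _ _); case: (uniq (flatten ts)).
  by rewrite lerD2l avg_nuniq.
(* The mean itself is the threshold: it is positive, so the indicator [G] must be 1 at a family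
   reaching it. *)
have : avgB D bs G <= avgB D bs G by [].
move=> /(avgB_exists D0)[ts [sts tsD Gts]]; exists ts; split=> //.
all: move: Gts; rewrite /G; case: (transversals _ _) => //=; case: (uniq (flatten ts)) => //= Gts.
all: by have := lt_le_trans small h; rewrite ltrDr ltNge Gts.
Qed.

End ExistsBlowup.

Section ColumnPattern.
Variables (K : realType) (m : nat) (T : finType) (H : mdigraph m T) (s : nat) (rho : K).
Hypotheses (m0 : (0 < m)%N) (s0 : (0 < s)%N).
Variable c0 : m.-tuple T.

Let Z := ('I_s * 'I_m)%type.

Definition cell (cs : seq (m.-tuple T)) (z : Z) : T := tnth (nth c0 cs z.1) z.2.

(* In the blow-up of a column pattern the entries of a column are replaced
   independently of each other, so only edges meeting each column at most once
   are guaranteed to survive. *)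
Definition one_per_column (f : m.-tuple Z) : bool :=
  [forall a, forall b, ((tnth f a).1 == (tnth f b).1) ==> (tnth f a == tnth f b)].

Definition column_pattern (cs : seq (m.-tuple T)) : {set m.-tuple Z} :=
  [set f | one_per_column f && ([tuple of map (cell cs) f] \in edges H)].

(** For fixed columns, the probability that one random entry from each of them forms an edge of the
    property graph. *)
Definition Spa_rows (cs : seq (m.-tuple T)) : K :=
  avg (enum 'I_m) s
    (fun js => (in_property_graph H s (fun G => Spa G rho) (entries cs js))%:R).

Lemma column_fractional cs : size cs = s ->
  exists om : m.-tuple Z -> K,
    [/\ forall f, 0 <= om f,
        forall z, \sum_(f in column_pattern cs) om f * (mult z f)%:R <= 1
      & (1 - rho) * s%:R * Spa_rows cs <= \sum_(f in column_pattern cs) om f].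
Proof.
move=> scs; set R := column_pattern cs.
pose i0 : 'I_m := Ordinal m0; pose j0 : 'I_s := Ordinal s0.
pose x0 : T := tnth c0 i0.
pose good js := in_property_graph H s (fun G => Spa G rho) (entries cs js).
have nth_entries js j : size js = s -> (j < s)%N ->
    nth x0 (entries cs js) j = tnth (nth c0 cs j) (nth i0 js j).
  move=> sjs jlt; rewrite (nth_map (c0, i0)) ?size_zip ?scs ?sjs ?minnn //.
  by rewrite nth_zip ?scs.
have size_entries js : size js = s -> size (entries cs js) = s.
  by move=> sjs; rewrite size_map size_zip scs sjs minnn.
have /choice[om omP] (js : seq 'I_m) : exists om : m.-tuple Z -> K, size js = s ->
   [/\ forall f, 0 <= om f,
       forall z, \sum_(f in R) om f * (mult z f)%:R <= (nth i0 js z.1 == z.2)%:R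
     & (1 - rho) * s%:R / m%:R * (good js)%:R <= \sum_(f in R) om f].
  have [gjs|ngjs] := boolP (good js); last first.
    exists (fun=> 0) => _; split=> // [z|]; last by rewrite mulr0 sumr_ge0.
    by rewrite big1 // => f _; rewrite mul0r.
  have [uS SH sS [w [wfrac wsize]]] := in_property_graphP gjs.
  set S := entries cs js in gjs uS SH sS wfrac wsize.
  case: (boolP (size js == s)) => [/eqP sjs|/eqP//]; last by exists (fun=> 0).
  (* A vertex of the chosen set is sent to its column and to the row that [js] selects there; [j0]
     is a default for vertices outside the set. *)
  pose idx x : Z := let j := insubd j0 (index x S) in (j, nth i0 js j).
  have idxK x : x \in S -> cell cs (idx x) = x.
    move=> xS; have xs : (index x S < s)%N by rewrite -[X in (_ < X)%N]sS index_mem.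
    by rewrite /cell /= insubdK // -nth_entries // nth_index.
  have [|om [om0 om1 omw]] := fractional_push (R := R) idxK wfrac.
    move=> e; rewrite /R !inE => /andP[eH /forallP eS].
    apply/andP; split.
      (* The row is a function of the column here, so a pushed edge meets each column in at most one
         cell. *)
      apply/forallP => a; apply/forallP => b; rewrite !tnth_map /idx /=.
      by apply/implyP => /eqP ->.
    suff -> : [tuple of map (cell cs) [tuple of map idx e]] = e by [].
    apply: val_inj => /=; rewrite -map_comp -[RHS]map_id; apply/eq_in_map => x.
    by move=> /tnthP[i ->]; have := eS i; rewrite inE; exact: idxK.
  exists om => _; split=> // [z|]; last first.
    rewrite omw mulr1; apply: le_trans wsize.
    rewrite /= cardsE (card_uniqP uS) sS; exact: lexx.
  apply: le_trans (om1 z) _; rewrite ler_nat; case: (_ \in S) => //=.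
  by case: z {om1} => j i; case: eqP => // -[] /= -> <-; rewrite eqxx.
(* A cell is selected by a proportion [1 / m] of the row choices, so the factor [m] raises its load
   to at most 1 and turns the size [(1 - rho) s / m] into [(1 - rho) s]. *)
exists (fun f => m%:R * avg (enum 'I_m) s (fun js => om js f)).
have I0 : (0 < size (enum 'I_m))%N by rewrite size_enum_ord.
have mK : m%:R != 0 :> K by rewrite pnatr_eq0 -lt0n.
split.
- by move=> f; rewrite mulr_ge0 // avg_ge0 // => js sjs _; case: (omP js sjs).
- move=> z.
  have -> : \sum_(f in R) m%:R * avg (enum 'I_m) s (fun js => om js f) * (mult z f)%:R =
      m%:R * avg (enum 'I_m) s (fun js => \sum_(f in R) om js f * (mult z f)%:R).
    rewrite avg_sum mulr_sumr; apply: eq_bigr => f _.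
    rewrite -mulrA; congr (_ * _); rewrite mulrC -avgZ.
    by apply: eq_avg => js _ _; rewrite mulrC.
  apply: le_trans (_ : m%:R * avg (enum 'I_m) s (fun js => (nth i0 js z.1 == z.2)%:R) <= _).
    by rewrite ler_wpM2l // avg_le // => js sjs _; case: (omP js sjs).
  rewrite (avg_nth I0 (fun i => (i == z.2)%:R)) // size_enum_ord.
  rewrite mulrC mulfVK // big_enum /= (bigD1 z.2) //= eqxx big1 ?addr0 // => i.
  by move=> /negbTE ->.
- have -> : \sum_(f in R) m%:R * avg (enum 'I_m) s (fun js => om js f) =
      m%:R * avg (enum 'I_m) s (fun js => \sum_(f in R) om js f).
    by rewrite avg_sum mulr_sumr.
  apply: le_trans (_ : m%:R * avg (enum 'I_m) s
     (fun js => (1 - rho) * s%:R / m%:R * (good js)%:R) <= _).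
    by rewrite avgZ mulrA [m%:R * _]mulrC mulfVK.
  by rewrite ler_wpM2l // avg_le // => js sjs _; case: (omP js sjs).
Qed.

End ColumnPattern.

Section Augment.
Variables (K : realType) (m : nat) (T : finType) (H : mdigraph m T) (s : nat).
Hypotheses (fH : fissile H) (m0 : (0 < m)%N) (s0 : (0 < s)%N).
Variable c0 : m.-tuple T.
Variables (es D : seq (m.-tuple T)).

(** Recording also which columns belong to the matching ensures that every part of a monochromatic
    blow-up lies inside [es] or avoids it. *)
Definition column_color (cs : seq (m.-tuple T)) :=
  (column_pattern H s c0 cs, [set j : 'I_s | nth c0 cs j \in es]).

Lemma nth_flatten_inj (C : eqType) (ts : seq (seq C)) c i j : uniq (flatten ts) ->
  c \in nth [::] ts i -> c \in nth [::] ts j -> i = j.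
Proof.
elim: ts i j => [|t ts IH] [|i] [|j] //=; rewrite ?nth_nil // cat_uniq => /and3P[_ h u].
- move=> ct cj; case/hasP: h; exists c => //; apply/flattenP.
  exists (nth [::] ts j) => //; apply: mem_nth; rewrite ltnNge; apply/negP => le.
  by rewrite nth_default in cj.
- move=> cj ct; case/hasP: h; exists c => //; apply/flattenP.
  exists (nth [::] ts i) => //; apply: mem_nth; rewrite ltnNge; apply/negP => le.
  by rewrite nth_default in cj.
- by move=> ci cj; rewrite (IH i j).
Qed.

Lemma uniq_matching (fs : seq (m.-tuple T)) :
  uniq (flatten (map val fs)) -> uniq fs.
Proof.
elim: fs => //= f fs IH; rewrite cat_uniq => /and3P[_ h /IH ->]; rewrite andbT.
apply/negP => ffs; case/hasP: h; exists (tnth f (Ordinal m0)); last exact: mem_tnth.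
by apply/flattenP; exists (val f); rewrite ?mem_tnth //; exact: map_f.
Qed.

Hypotheses (esH : {subset es <= edges H}) (esD : {subset es <= D}).
Hypothesis uD : uniq (flatten (map val D)).
Hypothesis DH : {subset flatten (map val D) <= verts H}.
Hypothesis ues : uniq (flatten (map val es)).

(** The blow-up has [b] columns in each part. Its [b #|J|] matching edges are traded for the edges
    of a rounded-down [b om]. Rounding loses at most one per pattern edge, less than the surplus
    [b / 16] by the choice of [b]. *)
Lemma augment (R : {set m.-tuple ('I_s * 'I_m)}) (J : {set 'I_s}) b ts
    (om : m.-tuple ('I_s * 'I_m) -> K) :
  (16 * #|{: m.-tuple ('I_s * 'I_m)}| < b)%N ->
  map size ts = nseq s b -> (forall t, t \in ts -> {subset t <= D}) ->
  transversals (fun cs => column_color cs == (R, J)) ts ->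
  uniq (flatten ts) ->
  (forall f, 0 <= om f) ->
  (forall z, \sum_(f in R) om f * (mult z f)%:R <= 1) ->
  #|J|%:R + 16%:R^-1 <= \sum_(f in R) om f ->
  exists es' : seq (m.-tuple T),
    [/\ {subset es' <= edges H}, uniq (flatten (map val es'))
      & (size es < size es')%N].
Proof.
move=> bbig sts tsD tr uts om0 om1 omJ.
have szts : size ts = s by rewrite -(size_map size) sts size_nseq.
have szb j : (j < s)%N -> size (nth [::] ts j) = b.
  by move=> js; rewrite -(nth_map _ 0%N) ?szts // sts nth_nseq js.
have b0 : (0 < b)%N by lia.
have blD j c : c \in nth [::] ts j -> c \in D.
  have [js|js] := ltnP j s; last by rewrite nth_default ?szts.
  by apply: tsD; rewrite mem_nth ?szts.
pose fst0 j := nth c0 (nth [::] ts j) 0.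
have fst0P j : (j < s)%N -> fst0 j \in nth [::] ts j.
  by move=> js; rewrite mem_nth ?szb.
have trP (g : nat -> m.-tuple T) : (forall j, (j < s)%N -> g j \in nth [::] ts j) ->
    column_pattern H s c0 (mkseq g s) = R /\
    [set j : 'I_s | nth c0 (mkseq g s) j \in es] = J.
  move=> gts; have : column_color (mkseq g s) == (R, J).
    apply: (transversalsP (x0 := c0) tr); first by rewrite size_mkseq szts.
    by move=> j; rewrite szts => js; rewrite nth_mkseq // gts.
  by rewrite /column_color xpair_eqE => /andP[/eqP-> /eqP->].
have opc f : f \in R -> one_per_column f.
  have [<- _] := trP _ fst0P; by rewrite inE => /andP[].
(* Any column of part [j] can be placed in a transversal, and all transversals have the colour
   [(R, J)]. *)
have inJ j c : (j < s)%N -> c \in nth [::] ts j ->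
    (c \in es) = (j \in map val (enum J)).
  move=> js cj; have [] := trP (fun i => if i == j then c else fst0 i).
    by move=> i si; case: eqP => [->//|_]; exact: fst0P.
  move=> _ /setP/(_ (Ordinal js)); rewrite inE nth_mkseq //= eqxx => ->.
  by rewrite -[j in RHS]/(val (Ordinal js)) mem_map ?mem_enum //; exact: val_inj.
pose V (z : 'I_s * 'I_m) := [set tnth c z.2 | c in nth [::] ts z.1].
have VD z x : x \in V z ->
    exists c, [/\ c \in nth [::] ts z.1, c \in D & x = tnth c z.2].
  by case/imsetP => c cz ->; exists c; split=> //; exact: blD cz.
have cV z : #|V z| = b.
  rewrite card_in_imset.
    rewrite -(szb z.1) //; apply/card_uniqP.
    have : uniq (flatten (take z.1 ts ++ drop z.1 ts)) by rewrite cat_take_drop.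
    rewrite (drop_nth [::]) ?szts //.
    by rewrite flatten_cat cat_uniq /= cat_uniq => /and3P[_ _ /and3P[]].
  move=> c c' cz cz' eqc.
  by have [] := uniq_flatten_inj uD (blD _ _ cz) (blD _ _ cz') eqc.
have [||||S [mS SV cS]] := @matchable_blowup_le _ _ _ fH m0 _ V
  (flatten [seq nseq (Num.truncn (b%:R * om f)) f | f <- enum R]).
- move=> z; apply/subsetP => x /VD[c [_ cD ->]]; apply: DH.
  by apply/flattenP; exists (val c); rewrite ?mem_tnth //; exact: map_f.
- move=> z z' nz; apply/pred0P => x /=; apply/negP => /andP[].
  move=> /VD[c [cz cD ->]] /VD[c' [cz' cD' eqc]].
  have [ecc ez2] := uniq_flatten_inj uD cD cD' eqc.
  case/eqP: nz; rewrite -ecc in cz'; have ez1 := nth_flatten_inj uts cz cz'.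
  by case: z z' ez1 ez2 {cz cz' eqc} => [? ?] [? ?] /= /val_inj -> ->.
- move=> f /flattenP[_ /mapP[f' f'R ->]]; rewrite mem_nseq => /andP[_ /eqP ef].
  subst f'; move: f'R; rewrite mem_enum => fR e /andP[/forallP pe /forallP se].
  (* A strictly preserving [e] is read off one transversal [g]: since [f] meets column [j] in at
     most one cell, a single column of part [j] supplies all entries of [e] at that column. Columns
     not met by [f] get an arbitrary representative. *)
  have /choice[g gP] (j : nat) : exists c, (j < s)%N -> c \in nth [::] ts j /\
      forall a, val (tnth f a).1 = j -> tnth e a = tnth c (tnth f a).2.
    have [a /eqP aj|na] := pickP (fun a => val (tnth f a).1 == j).
      have [c [cj _ ec]] := VD _ _ (pe a); exists c => _; split; first by rewrite -aj.
      move=> a' aj'; have fa : tnth f a = tnth f a'.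
        apply/eqP; move/forallP: (opc f fR) => /(_ a)/forallP/(_ a')/implyP; apply.
        by apply/eqP/val_inj; rewrite aj aj'.
      rewrite -fa -ec; apply/esym/eqP; move/forallP: (se a) => /(_ a')/implyP; apply.
      by rewrite fa.
    exists (fst0 j) => js; split; first exact: fst0P.
    by move=> a aj; have := na a; rewrite aj eqxx.
  have [Rl _] := trP g (fun j js => (gP j js).1).
  have : f \in column_pattern H s c0 (mkseq g s) by rewrite Rl.
  rewrite inE => /andP[_].
  suff -> : [tuple of map (cell c0 (mkseq g s)) f] = e by [].
  apply: eq_from_tnth => a; rewrite tnth_map /cell nth_mkseq //.
  by rewrite -(gP _ (ltn_ord _)).2.
- move=> z; rewrite cV big_flatten big_map /= -(ler_nat K) natr_sum.
  apply: le_trans (_ : b%:R * \sum_(f in R) om f * (mult z f)%:R <= _).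
    rewrite mulr_sumr big_enum; apply: ler_sum => f _.
    rewrite big_nseq iter_addn_0 natrM mulrC mulrA ler_wpM2r //.
    by rewrite truncn_le mulr_ge0.
  by rewrite ler_piMr.
have [es' [es'H ues' eS]] := mS.
have ses' : size es' = size (flatten [seq nseq (Num.truncn (b%:R * om f)) f | f <- enum R]).
  apply/eqP; rewrite -(eqn_pmul2l m0) -cS eS cardsE -size_flatten_tuples.
  by apply/eqP/esym/card_uniqP.
(* The matching edges outside the blow-up are kept; those inside are replaced by [es']. *)
exists ([seq e <- es | e \notin flatten ts] ++ es'); split.
- by move=> e; rewrite mem_cat mem_filter => /orP[/andP[_ /esH]|/es'H].
- rewrite map_cat flatten_cat cat_uniq ues' andbT; apply/andP; split.
    have : perm_eq (flatten (map val ([seq e <- es | e \notin flatten ts] ++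
       [seq e <- es | ~~ (e \notin flatten ts)]))) (flatten (map val es)).
      apply: perm_flatten; apply: perm_map; by rewrite perm_filterC.
    move=> /perm_uniq; rewrite ues map_cat flatten_cat cat_uniq.
    by case: (uniq _).
  apply/hasPn => x xes'; apply/negP => /flattenP[_ /mapP[e + ->] xe].
  rewrite mem_filter => /andP[ets ees].
  have : x \in S by rewrite eS inE.
  move=> /(subsetP SV)/bigcupP[z _ /VD[c [cz cD xc]]].
  move: xe => /tnthP[i xi]; rewrite xc in xi.
  have [ce _] := uniq_flatten_inj uD cD (esD ees) xi.
  case/negP: ets; rewrite -ce; apply/flattenP; exists (nth [::] ts z.1) => //.
  by rewrite mem_nth // szts.
- rewrite size_cat size_filter.
  have -> : count (fun e => e \notin flatten ts) es = (size es - count (mem (flatten ts)) es)%N.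
    by rewrite -(count_predC (mem (flatten ts)) es) addKn.
  have le1 : (count (mem (flatten ts)) es <= b * #|J|)%N.
    apply: leq_trans (_ : count (mem es) (flatten ts) <= _)%N.
      rewrite -!size_filter; apply: uniq_leq_size.
        by rewrite filter_uniq // uniq_matching.
      by move=> e; rewrite !mem_filter /= andbC.
    rewrite count_flatten sumnE big_map (big_nth [::]) big_mkord szts.
    rewrite (eq_bigr (fun j : 'I_s => if j \in J then b else 0))%N; last first.
      move=> j _; case: ifP => jJ.
        rewrite -(szb j) //; apply/eqP; rewrite -all_count; apply/allP => c cj /=.
        by rewrite (inJ j) // mem_map ?mem_enum //; exact: val_inj.
      apply/eqP; rewrite -leqn0 leqNgt -has_count; apply/hasPn => c cj /=.
      by rewrite (inJ j) // mem_map ?mem_enum ?jJ //; exact: val_inj.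
    by rewrite -big_mkcond sum_nat_const mulnC.
  have le2 : (count (mem (flatten ts)) es <= size es)%N by exact: count_size.
  suff : (b * #|J| < size es')%N by lia.
  rewrite ses' size_flatten /shape -map_comp sumnE big_map big_enum /=.
  rewrite -(ltr_nat K) natr_sum.
  apply: lt_le_trans (_ : \sum_(f in R) (b%:R * om f - 1) <= _); last first.
    apply: ler_sum => f _; rewrite size_nseq lerBlDr natr1 ltW //.
    by apply: truncnS_gt.
  rewrite sumrB -mulr_sumr sumr_const natrM ltrBrDr.
  have h : b%:R * (#|J|%:R + 16%:R^-1) <= b%:R * \sum_(f in R) om f :> K.
    by rewrite ler_wpM2l.
  apply: lt_le_trans h; rewrite mulrDr ltrD2l.
  apply: le_lt_trans (_ : #|{: m.-tuple ('I_s * 'I_m)}|%:R < _).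
    by rewrite ler_nat max_card.
  by rewrite ltr_pdivlMr // -natrM ltr_nat mulnC.
Qed.

End Augment.

Section Gain.
Variables (K : realType) (m : nat) (T : finType) (H : mdigraph m T) (s : nat) (rho : K).
Hypotheses (m2 : (2 <= m)%N) (ms : (m <= s)%N).
Hypotheses (rho0 : 0 < rho) (rho1 : rho <= 2%:R^-1).
Variables (es us : seq (m.-tuple T)).

(** The size guaranteed by [column_fractional] minus the number of matching edges among the
    columns. *)
Definition gain (cs : seq (m.-tuple T)) : K :=
  (1 - rho) * s%:R * Spa_rows H s rho cs - (count (mem es) cs)%:R.

Definition gains (cs : seq (m.-tuple T)) : bool := 16%:R^-1 <= gain cs.

Hypothesis cover : perm_eq (flatten (map val (us ++ es))) (enum (verts H)).
Hypothesis rob : robustly K s (fun G => Spa G rho) H.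
Hypothesis big : (8 * s ^ 3 <= #|verts H|)%N.
Hypothesis many : rho * (size (us ++ es))%:R <= (size us)%:R.

Hypothesis usNes : forall c, c \in us -> c \notin es.

Let D := us ++ es.

(* The robust degree condition is applied to an uncovered vertex, so the first
   column [c] is fixed among the uncovered ones; this is what makes the threshold
   [1 - 1 / s ^ 2] sufficient for every [s]. *)
Lemma avg_gain_from c : c \in us ->
  8%:R^-1 <= avg D s.-1 (fun cs => gain (c :: cs)).
Proof.
have [r0 r1] := (rho0, rho1).
move=> cus; have ces := usNes cus; have m0 : (0 < m)%N by lia.
have D0 : (0 < size D)%N by rewrite /D size_cat; case: (us) cus.
have N0 : (size D)%:R != 0 :> K by rewrite pnatr_eq0 -lt0n.
have s0 : (0 < s)%N by lia.
have sK : 2%:R <= s%:R :> K by rewrite ler_nat; lia.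
have sK0 : 0 < s%:R :> K by lra.
have n0 : 0 < #|verts H|%:R :> K by rewrite ltr0n; nia.
pose e : K := s%:R ^+ 2 / #|verts H|%:R.
have e0 : 0 <= e by rewrite mulr_ge0 ?invr_ge0 ?exprn_ge0 // ltW.
have e1 : e * s%:R <= 8%:R^-1.
  rewrite /e mulrAC ler_pdivrMr // [leRHS]mulrC ler_pdivlMr // -!natrX -!natrM ler_nat.
  by rewrite -expnSr mulnC.
have rowsge : 1 - (s%:R ^+ 2)^-1 - e <= avg D s.-1 (fun cs => Spa_rows H s rho (c :: cs)).
  have -> : avg D s.-1 (fun cs => Spa_rows H s rho (c :: cs)) =
     (m%:R)^-1 * \sum_(i < m) avg (flatten (map val D)) s.-1
       (fun l => (in_property_graph H s (fun G => Spa G rho) (tnth c i :: l))%:R).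
    rewrite /Spa_rows -[s in avg (enum _) s](prednK s0).
    rewrite (eq_avg (G := fun cs => (m%:R)^-1 * \sum_(i <- enum 'I_m)
      avg (enum 'I_m) s.-1 (fun js => (in_property_graph H s (fun G => Spa G rho)
        (tnth c i :: entries cs js))%:R))); last first.
      by move=> cs _ _; rewrite avgS size_enum_ord mulrC.
    rewrite avgZ avg_sum big_enum; congr (_ * _); apply: eq_bigr => i _.
    by rewrite -avg_entries.
  rewrite mulrC ler_pdivlMr ?ltr0n // mulr_natr -[m in _ *+ m]card_ord -sumr_const.
  apply: ler_sum => i _; apply: robustly_avg => //.
  rewrite -mem_enum -(perm_mem cover); apply/flattenP; exists (val c).
    by apply: map_f; rewrite mem_cat cus.
  exact: mem_tnth.
have cnt : avg D s.-1 (fun cs => (count (mem es) (c :: cs))%:R) <=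
    (s%:R - 1) * (1 - rho) :> K.
  rewrite /= (negbTE ces) avg_count // -subn1 natrB // -mulrA ler_wpM2l ?subr_ge0 ?ler1n //.
  rewrite ler_pdivrMr ?ltr0n // mulrBl mul1r lerBrDr.
  apply: le_trans (lerD (lexx _) many) _; rewrite -natrD ler_nat /D size_cat addnC leq_add2l.
  rewrite count_cat (eq_in_count (a2 := pred0)) ?count_pred0 ?count_size //.
  by move=> c' /usNes /negbTE.
rewrite /gain avg_sub avgZ; set A := avg _ _ _ in rowsge *.
have h1 : (1 - rho) * s%:R * (1 - (s%:R ^+ 2)^-1 - e) <= (1 - rho) * s%:R * A.
  by apply: ler_wpM2l => //; apply: mulr_ge0; lra.
have h2 : s%:R * (s%:R ^+ 2)^-1 <= 2%:R^-1 :> K.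
  by rewrite expr2 invfM mulrA divff ?gt_eqF // mul1r lef_pV2 ?posrE.
(* After cancellation of the main terms the expected gain is at least [(1 - rho) (1 - 1 / s - e s)].
   With [rho <= 1 / 2], [s >= 2] and [e s <= 1 / 8] this is at least [3 / 16]. *)
have h3 : 2%:R^-1 * (3%:R / 8%:R) <=
    (1 - rho) * (1 - s%:R * (s%:R ^+ 2)^-1 - e * s%:R) :> K.
  by apply: ler_pM; lra.
have -> : 8%:R^-1 = 2%:R^-1 * (3%:R / 8%:R) - 16%:R^-1 :> K by field.
have h4 : 0 <= 16%:R^-1 :> K by rewrite invr_ge0.
lra.
Qed.

(** Reverse Markov inequality: the gain never exceeds [s], so a mean of at least [1 / 8] forces a
    gain of at least [1 / 16] with probability [1 / (16 s)]. The first column is uncovered with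
    probability at least [rho]. *)
Lemma avg_gain : rho / (16%:R * s%:R) <=
  avg D s (fun cs => (gains cs)%:R) :> K.
Proof.
have [r0 r1] := (rho0, rho1); have s0 : (0 < s)%N by lia.
have sK0 : 0 < s%:R :> K by rewrite ltr0n.
have D0 : (0 < size D)%N.
  rewrite lt0n; apply/eqP => D0; have := perm_size cover.
  by rewrite size_flatten_tuples D0 muln0 -cardE => /esym e0; move: big; nia.
have h c : c \in us -> (16%:R * s%:R)^-1 <=
    avg D s.-1 (fun cs => (gains (c :: cs))%:R) :> K.
  move=> /avg_gain_from h; rewrite invfM ler_pdivrMr // mulrC.
  have : avg D s.-1 (fun cs => gain (c :: cs)) <=
     avg D s.-1 (fun cs => s%:R * (gains (c :: cs))%:R + 16%:R^-1).
    apply: avg_le => cs _ _; rewrite /gains; case: (lerP 16%:R^-1 (gain (c :: cs))) => [_|/ltW].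
      rewrite mulr1 /gain; set A := Spa_rows _ _ _ _.
      have A1 : A <= 1.
        rewrite -[1](avg_const (D := enum 'I_m) _ s); last by rewrite size_enum_ord; lia.
        by apply: avg_le => js _ _; rewrite lern1 leq_b1.
      have A0 : 0 <= A by apply: avg_ge0.
      have : (1 - rho) * s%:R * A <= 1 * s%:R * 1.
        apply: ler_pM => //; first by rewrite mulr_ge0 //; lra.
        by rewrite ler_wpM2r //; lra.
      have : 0 <= (count (mem es) (c :: cs))%:R :> K by [].
      have : 0 <= 16%:R^-1 :> K by rewrite invr_ge0.
      lra.
    by rewrite mulr0 add0r.
  move=> /(le_trans h); rewrite avgD avgZ avg_const //; lra.
rewrite -[s in avg D s](prednK s0) avgS ler_pdivlMr ?ltr0n // /D big_cat /=.
apply: le_trans (_ : \sum_(c <- us) (16%:R * s%:R)^-1 <= _); last first.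
  rewrite -[leLHS]addr0 lerD //; last by apply: sumr_ge0 => c _; apply: avg_ge0.
  by rewrite big_seq [leRHS]big_seq ler_sum.
rewrite big_const_seq iter_addr_0 count_predT -[_ *+ size us]mulr_natl.
by rewrite mulrAC ler_wpM2r // invr_ge0 mulr_ge0 // ltW.
Qed.

End Gain.

(** A matching of maximum size is taken. If it left too much uncovered, [avg_gain], the pigeonhole
    over column colours and [exists_blowup] would feed [augment], against maximality. *)
Lemma uncovered_bound (K : realType) (m s : nat) (rho : K) :
  (2 <= m)%N -> (m <= s)%N -> 0 < rho -> rho <= 2%:R^-1 ->
  exists n0 : nat, forall (T : finType) (H : mdigraph m T),
    (n0 <= #|verts H|)%N -> (m %| #|verts H|)%N -> fissile H ->
    robustly K s (fun G => Spa G rho) H ->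
    exists2 S : {set T}, matchable H S &
      #|verts H :\: S|%:R <= rho * #|verts H|%:R.
Proof.
move=> m2 ms rho0 rho1; have m0 : (0 < m)%N by lia.
have s0 : (0 < s)%N by lia.
pose Z := ('I_s * 'I_m)%type; pose Q := ({set m.-tuple Z} * {set 'I_s})%type.
pose c : K := rho / (16%:R * s%:R); pose d0 : K := c / #|{: Q}|%:R.
have c_gt0 : 0 < c by rewrite divr_gt0 // mulr_gt0 // ltr0n.
have Q0 : (0 < #|{: Q}|)%N by apply/card_gt0P; exists (set0, set0).
have d_gt0 : 0 < d0 by rewrite divr_gt0 // ltr0n.
pose b := (16 * #|{: m.-tuple Z}|).+1; pose bs := nseq s b.
pose X : K := (sumn bs)%:R ^+ 2 / d0 ^+ (\prod_(x <- bs) x).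
have X0 : 0 <= X by rewrite divr_ge0 ?exprn_ge0 // ltW.
(* The first term gives more than [X] columns, as [exists_blowup] requires; the second makes the
   error in [robustly_avg] small enough for the gain estimate. *)
exists (m * Num.bound X + 8 * s ^ 3)%N => T H nH mH fH rob.
pose is_size k := `[< exists es : seq (m.-tuple T),
  [/\ {subset es <= edges H}, uniq (flatten (map val es)) & size es = k] >].
have size_le k : is_size k -> (k <= #|T|)%N.
  move=> /asboolP[es [_ ues <-]]; apply: leq_trans (_ : m * size es <= _)%N.
    by rewrite leq_pmull.
  by rewrite -size_flatten_tuples; have /card_uniqP <- := ues; exact: max_card.
have [k /asboolP[es [esH ues <-]] kmax] : exists2 k, is_size k &
    forall j, is_size j -> (j <= k)%N.
  have ex0 : exists k, is_size k by exists 0; apply/asboolP; exists [::].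
  by case: (ex_maxnP ex0 size_le) => k; exists k.
set S := [set x in flatten (map val es)].
have mS : matchable H S by exists es.
exists S => //; rewrite leNgt; apply/negP => many.
have SH := matchable_sub mS.
have cS : #|S| = (m * size es)%N.
  by rewrite cardsE -size_flatten_tuples; apply/card_uniqP.
case/dvdnP: (mH) => N HN.
have cHS : #|verts H :\: S| = ((N - size es) * m)%N.
  by rewrite cardsD (setIidPr SH) cS HN mulnC -mulnBr mulnC.
have Nes : (size es <= N)%N.
  by have := subset_leq_card SH; rewrite cS HN mulnC leq_pmul2r.
(* Both [#|verts H|] and [#|S|] are multiples of [m], so the uncovered vertices split exactly into
   columns. These tuples need not be edges. *)
have [us usE sus] : exists2 us : seq (m.-tuple T),
    flatten (map val us) = enum (verts H :\: S) & size us = (N - size es)%N.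
  by apply: tuples_of_seq; rewrite -cardE.
have usU c' x : c' \in us -> x \in c' -> (x \in verts H) && (x \notin S).
  move=> c'us xc'; have : x \in enum (verts H :\: S).
    by rewrite -usE; apply/flattenP; exists (val c') => //; exact: map_f.
  by rewrite mem_enum inE andbC.
pose D := us ++ es.
have cover : perm_eq (flatten (map val D)) (enum (verts H)).
  rewrite /D map_cat flatten_cat usE; apply: uniq_perm => [||x]; last first.
  - rewrite mem_cat !mem_enum in_setD.
    have <- : (x \in S) = (x \in flatten (map val es)) by rewrite inE.
    by have := subsetP SH x; case: (x \in S) => /= [->//|_]; rewrite orbF.
  - exact: enum_uniq.
  rewrite cat_uniq enum_uniq ues andbT; apply/hasPn => x xes.
  by rewrite mem_enum !inE xes.
have usNes c' : c' \in us -> c' \notin es.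
  move=> c'us; apply/negP => c'es.
  have /andP[_ /negP[]] := usU _ _ c'us (mem_tnth (Ordinal m0) c').
  by rewrite inE; apply/flattenP; exists (val c'); rewrite ?mem_tnth //; exact: map_f.
have sD : size D = N by rewrite size_cat sus subnK.
have manyD : rho * (size D)%:R <= (size us)%:R.
  move: many; rewrite cHS HN sD sus !natrM mulrA ltr_pM2r ?ltr0n //.
  exact: ltW.
have big : (8 * s ^ 3 <= #|verts H|)%N := leq_trans (leq_addl _ _) nH.
have := avg_gain m2 ms rho0 rho1 cover rob big manyD usNes.
rewrite -/D -/c => gn.
have D0 : (0 < size D)%N.
  have h8 : (0 < 8 * s ^ 3)%N by rewrite muln_gt0 expn_gt0 s0.
  by have := leq_trans h8 big; rewrite HN muln_gt0 sD => /andP[].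
have [c0 _] : exists c0, c0 \in D by case: (D) D0 => // x ? _; exists x; rewrite inE eqxx.
(* The fractional matching with its surplus of [1 / 16] depends on the colour alone, so it can be
   taken as a property of colours in the pigeonhole. *)
pose good (q : Q) := `[< exists om : m.-tuple Z -> K,
   [/\ forall f, 0 <= om f,
       forall z, \sum_(f in q.1) om f * (mult z f)%:R <= 1
     & #|q.2|%:R + 16%:R^-1 <= \sum_(f in q.1) om f] >].
have [|[R J] /asboolP[om [/= om0 om1 omJ]] dq] :=
    avg_pigeonhole (col := column_color H s c0 es) (good := good) c_gt0 _ gn.
  move=> cs scs csD; rewrite /gains /gain => g; apply/asboolP.
  have [om [om0 om1 omw]] := column_fractional H rho m0 s0 c0 scs.
  exists om; split=> //=; apply: le_trans omw.
  have -> : #|[set j : 'I_s | nth c0 cs j \in es]| = count (mem es) cs.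
    rewrite -sum1_count (big_nth c0) scs big_mkord -sum1_card.
    by apply: eq_bigl => j; rewrite inE.
  by rewrite addrC -lerBrDr.
have uD : uniq (flatten (map val D)) by rewrite (perm_uniq cover) enum_uniq.
have [|||ts [sts tsD tr uts]] := exists_blowup (bs := bs)
   (F := fun cs => column_color H s c0 es cs == (R, J)) (d := d0) D0.
- exact: uniq_matching m0 _ uD.
- by rewrite ltW // /bs size_nseq.
- rewrite ltr_pdivrMr ?ltr0n // mulrC -ltr_pdivrMr ?exprn_gt0 // -/X.
  apply: lt_le_trans (archi_boundP X0) _; rewrite ler_nat sD.
  by rewrite -(leq_pmul2r m0) -HN; apply: leq_trans nH; rewrite mulnC leq_addr.
have [|||es' [es'H ues' ses']] := @augment K m T H s fH m0 s0 c0 es D esH _ uD _ ues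
    R J b ts om _ sts tsD tr uts om0 om1 omJ.
- by move=> e ees; rewrite mem_cat ees orbT.
- by move=> x; rewrite (perm_mem cover) mem_enum.
- exact: ltnSn.
have : is_size (size es') by apply/asboolP; exists es'.
by move/kmax; rewrite leqNgt ses'.
Qed.

(** * Absorbers *)

Section Blocks.
Variables (K : realFieldType) (C : eqType) (D : seq C).
Variables (f : C -> pred (seq C)) (q : nat).

Fixpoint blocks (xs l : seq C) : bool :=
  if xs is x :: xs' then f x (take q l) && blocks xs' (drop q l) else true.

Lemma avg_blocks (p : K) xs : (0 < size D)%N -> 0 <= p ->
  (forall x, x \in xs -> p <= avg D q (fun l => (f x l)%:R)) ->
  p ^+ size xs <= avg D (size xs * q) (fun l => (blocks xs l)%:R).
Proof.
move=> D0 p0; elim: xs => [|x xs IH] pf; first by rewrite expr0 /= lexx.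
rewrite /= mulSn exprS.
apply: le_trans (_ : _ <= avg D (q + size xs * q) (fun l =>
  (f x (take q l))%:R * (blocks xs (drop q l))%:R)) _; last first.
  by apply: avg_le => l _ _; rewrite -natrM mulnb.
apply: (avg_mul (F := fun t => (f x t)%:R) (G := fun _ l => (blocks xs l)%:R)) => //.
- exact: exprn_ge0.
- by apply: pf; rewrite inE eqxx.
- by move=> *; apply: IH => y yxs; apply: pf; rewrite inE yxs orbT.
Qed.

Lemma blocksP xs l x : blocks xs l -> x \in xs ->
  exists2 t, {subset t <= l} & f x t.
Proof.
elim: xs l => //= y xs IH l /andP[fy /IH h]; rewrite inE => /predU1P[->|/h[t tl ft]].
  by exists (take q l) => // z /mem_take.
by exists t => // z /tl /mem_drop.
Qed.

Lemma blocks_mem xs l v : blocks xs l -> size l = (size xs * q)%N -> v \in l ->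
  exists x t, [/\ x \in xs, v \in t, {subset t <= l} & f x t].
Proof.
elim: xs l => [|y xs IH] l /=; first by move=> _ /size0nil ->.
move=> /andP[fy bl] sl; rewrite -{1}(cat_take_drop q l) mem_cat => /orP[vt|vd].
  by exists y, (take q l); split; rewrite ?inE ?eqxx // => z /mem_take.
have [|x [t [xxs vt tl fx]]] := IH _ bl _ vd; first by rewrite size_drop sl; lia.
by exists x, t; split; rewrite ?inE ?xxs ?orbT // => z /tl /mem_drop.
Qed.

End Blocks.

(** * The lattice of edge vectors and linked lists *)

Section Lattice.
Variables (m : nat) (T : finType) (H : mdigraph m T).

(** Lattice elements are encoded as differences of two multisets of edges instead of integer
    weights, since the absorber is built from the two multisets. *)
Definition edge_lattice (Y : seq T) (u : T -> int) : Prop :=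
  exists p q : seq (m.-tuple T),
    (forall e, e \in p ++ q -> e \in edges H /\ {subset e <= Y}) /\
    forall v, u v = \sum_(e <- p) (mult v e)%:R - \sum_(e <- q) (mult v e)%:R.

Variable Y : seq T.

Lemma edge_lattice_ext u u' : (forall v, u v = u' v) ->
  edge_lattice Y u -> edge_lattice Y u'.
Proof.
by move=> uu' [p [q [pq e]]]; exists p, q; split=> // v; rewrite -uu' e.
Qed.

Lemma edge_lattice0 : edge_lattice Y (fun=> 0).
Proof. by exists [::], [::]; split=> // v; rewrite !big_nil subrr. Qed.

Lemma edge_latticeD u u' : edge_lattice Y u -> edge_lattice Y u' ->
  edge_lattice Y (fun v => u v + u' v).
Proof.
move=> [p [q [pq e]]] [p' [q' [pq' e']]]; exists (p ++ p'), (q ++ q'); split.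
  move=> g; rewrite !mem_cat => gin.
  have : (g \in p ++ q) || (g \in p' ++ q').
    by move: gin; rewrite !mem_cat; do 4!case: (g \in _).
  by case/orP => [/pq|/pq'].
by move=> v; rewrite e e' !big_cat /=; ring.
Qed.

Lemma edge_latticeN u : edge_lattice Y u -> edge_lattice Y (fun v => - u v).
Proof.
move=> [p [q [pq e]]]; exists q, p; split; last by move=> v; rewrite e opprB.
by move=> g; rewrite mem_cat orbC -mem_cat; exact: pq.
Qed.

Lemma edge_latticeB u u' : edge_lattice Y u -> edge_lattice Y u' ->
  edge_lattice Y (fun v => u v - u' v).
Proof. by move=> uY u'Y; apply: edge_latticeD uY (edge_latticeN u'Y). Qed.

Lemma edge_latticeZ (c : int) u : edge_lattice Y u -> edge_lattice Y (fun v => c * u v).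
Proof.
move=> uY; have hn (n : nat) : edge_lattice Y (fun v => n%:R * u v).
  elim: n => [|n IH].
    by apply: edge_lattice_ext edge_lattice0 => v; rewrite mul0r.
  by apply: edge_lattice_ext (edge_latticeD uY IH) => v; rewrite -natr1; ring.
case: c => n; first by apply: edge_lattice_ext (hn n) => v; rewrite natz.
apply: edge_lattice_ext (edge_latticeN (hn n.+1)) => v.
by rewrite NegzE natz mulNr.
Qed.

Lemma edge_lattice_sum (I : eqType) (s : seq I) (P : pred I) (u : I -> T -> int) :
  (forall i, i \in s -> P i -> edge_lattice Y (u i)) ->
  edge_lattice Y (fun v => \sum_(i <- s | P i) u i v).
Proof.
elim: s => [|i s IH] us.
  by apply: edge_lattice_ext edge_lattice0 => v; rewrite big_nil.
have {}IH : edge_lattice Y (fun v => \sum_(i <- s | P i) u i v).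
  by apply: IH => j js; apply: us; rewrite inE js orbT.
have [Pi|nPi] := boolP (P i); last first.
  by apply: edge_lattice_ext IH => v; rewrite big_cons (negbTE nPi).
apply: edge_lattice_ext (edge_latticeD (us i _ Pi) IH) => [v|]; last by rewrite inE eqxx.
by rewrite big_cons Pi.
Qed.

Lemma edge_lattice_edge e : e \in edges H -> {subset e <= Y} ->
  edge_lattice Y (fun v => (mult v e)%:R).
Proof.
move=> eH eY; exists [:: e], [::]; split; first by move=> g; rewrite inE => /eqP ->.
by move=> v; rewrite big_seq1 big_nil subr0.
Qed.

Lemma edge_lattice_Div (S : seq T) : {subset S <= Y} ->
  Div (induced H [set x in S]) -> edge_lattice Y (fun v => (v \in S)%:R).
Proof.
move=> SY [w wS].
have : edge_lattice Y (fun v => \sum_(e in edges (induced H [set x in S]))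
    w e * (mult v e)%:R).
  apply: edge_lattice_sum => e _; rewrite inE => /andP[eH /forallP eS].
  apply/edge_latticeZ/edge_lattice_edge => // x /tnthP[i ->].
  by apply: SY; have := eS i; rewrite inE.
apply: edge_lattice_ext => v; case: (boolP (v \in S)) => vS.
  by apply: wS; rewrite inE.
rewrite big1 // => e; rewrite inE => /andP[_ /forallP eS].
rewrite mult_notin ?mulr0 //; apply/negP => /tnthP[i vi].
by have := eS i; rewrite inE -vi (negbTE vS).
Qed.

End Lattice.

Section AbsorbingList.
Variables (K : realType) (m : nat) (T : finType) (H : mdigraph m T) (r : nat).
Hypotheses (m2 : (2 <= m)%N) (mr : (m <= r)%N).

Let PG (l : seq T) : bool :=
  in_property_graph H r (fun G => Div G /\ Cov G) l.

(** One block of length [r - 1] for the hub vertex and one for each of the [m] vertices to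
    absorb. *)
Definition hub_size := (m.+1 * r.-1)%N.
Definition list_size := (hub_size + hub_size * r.-1).+1.

(* [l] consists of a hub [h], one block completing each of [h] and the elements
   of [X] to an edge of the property graph, and, for every [t] in these blocks,
   one further block completing both [t] and [h]. *)
Definition linked (X l : seq T) : bool :=
  if l is h :: l' then
    [&& blocks (fun x t => PG (x :: t)) r.-1 (h :: X) (take hub_size l'),
        blocks (fun y t => PG (y :: t) && PG (h :: t)) r.-1
          (take hub_size l') (drop hub_size l')
      & uniq (X ++ l)]
  else false.

(** The block conditions are [m + 1 + hub_size] successive events, each of conditional probability
    at least [1 / 4]. Half of the product pays for repeated entries and for entries in [X]. *)
Lemma linked_density (X : seq T) : robustly K r (fun G => Div G /\ Cov G) H ->
  uniq X -> {subset X <= verts H} -> size X = m ->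
  (2 * list_size * (list_size + m) * 4 ^ (m.+1 + hub_size) <= #|verts H|)%N ->
  (4%:R^-1 ^+ (m.+1 + hub_size)) / 2%:R <=
  avg (enum (verts H)) list_size (fun l => (linked X l)%:R) :> K.
Proof.
move=> rob uX XH sX big; set D := enum _; set n := #|verts H| in big.
have sD : size D = n by rewrite -cardE.
have ls0 : (0 < list_size)%N by [].
have r2 : (2 <= r)%N by lia.
have n0 : (0 < n)%N.
  by apply: leq_trans big; rewrite !muln_gt0 expn_gt0 addn_gt0 ls0.
have D0 : (0 < size D)%N by rewrite sD.
have nK : 0 < n%:R :> K by rewrite ltr0n.
have big16 : (16 * r ^ 2 <= n)%N.
  apply: leq_trans big; rewrite mulnC leq_mul //.
    have rls : (r <= list_size)%N.
      rewrite -[r](prednK (ltnW r2)) ltnS /hub_size.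
      by apply: leq_trans (leq_addr _ _); rewrite leq_pmull.
    by rewrite -mulnn leq_mul // (leq_trans rls) ?leq_pmull ?leq_addr.
  by rewrite -[16%N]/(4 ^ 2)%N leq_exp2l // addSn ltnS addn_gt0; lia.
(* The loss [5 / 16] is [1 / 4] from [1 / r ^ 2] with [r >= 2], plus [1 / 16] from drawing with
   repetition. *)
have deg v : v \in verts H ->
    1 - 5%:R / 16%:R <= avg D r.-1 (fun l => (PG (v :: l))%:R) :> K.
  move=> vH; have r0 : (0 < r)%N by lia.
  have h := robustly_avg r0 rob (perm_refl _) vH; apply: le_trans h.
  have h1 : r%:R ^+ 2 / n%:R <= 16%:R^-1 :> K.
    rewrite ler_pdivrMr // mulrC ler_pdivlMr // -natrX -natrM ler_nat.
    by rewrite mulnC.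
  have h2 : (r%:R ^+ 2)^-1 <= 4%:R^-1 :> K.
    rewrite lef_pV2 ?posrE ?exprn_gt0 ?ltr0n // -natrX ler_nat.
    by rewrite -[4%N]/(2 ^ 2)%N leq_exp2r.
  rewrite -/n; lra.
(* Two events of probability at least [11 / 16] overlap with probability at least [3 / 8]. *)
have deg2 v w : v \in verts H -> w \in verts H ->
    4%:R^-1 <= avg D r.-1 (fun l => (PG (v :: l) && PG (w :: l))%:R) :> K.
  move=> vH wH; have h1 := deg v vH; have h2 := deg w wH.
  have : avg D r.-1 (fun l => (PG (v :: l))%:R) + avg D r.-1 (fun l => (PG (w :: l))%:R)
     <= 1 + avg D r.-1 (fun l => (PG (v :: l) && PG (w :: l))%:R) :> K.
    rewrite -[X in _ <= X + _](avg_const D0 r.-1) -!avgD; apply: avg_le => l _ _.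
    by case: (PG _); case: (PG _) => /=; lra.
  lra.
set p : K := 4%:R^-1 in deg2 *.
have p0 : 0 <= p by rewrite invr_ge0.
pose L (l : seq T) : bool := if l is h :: l' then
  blocks (fun x t => PG (x :: t)) r.-1 (h :: X) (take hub_size l') &&
  blocks (fun y t => PG (y :: t) && PG (h :: t)) r.-1
          (take hub_size l') (drop hub_size l') else false.
have Lge : p ^+ (m.+1 + hub_size) <= avg D list_size (fun l => (L l)%:R).
  rewrite avgS ler_pdivlMr ?ltr0n //.
  have -> : p ^+ (m.+1 + hub_size) * (size D)%:R =
      \sum_(h <- D) p ^+ (m.+1 + hub_size).
    by rewrite big_const_seq iter_addr_0 count_predT mulr_natr.
  rewrite big_seq [leRHS]big_seq; apply: ler_sum => h; rewrite mem_enum => hH.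
  rewrite exprD.
  apply: le_trans (_ : _ <= avg D (hub_size + hub_size * r.-1) (fun l =>
    (blocks (fun x t => PG (x :: t)) r.-1 (h :: X) (take hub_size l))%:R *
    (blocks (fun y t => PG (y :: t) && PG (h :: t)) r.-1
          (take hub_size l) (drop hub_size l))%:R)) _; last first.
    by apply: avg_le => l _ _; rewrite -natrM mulnb.
  apply: (avg_mul (F := fun l => (blocks (fun x t => PG (x :: t)) r.-1 (h :: X) l)%:R)
    (G := fun t l => (blocks (fun y t => PG (y :: t) && PG (h :: t)) r.-1 t l)%:R)) => //.
  - exact: exprn_ge0.
  - exact: exprn_ge0.
  - rewrite /hub_size -sX -[(size X).+1]/(size (h :: X)); apply: avg_blocks => // x xX.
    apply: le_trans (deg x _); first by rewrite /p; lra.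
    by move: xX; rewrite inE => /predU1P[->|/XH].
  - move=> t st tD _; rewrite -{1}st -{1}st; apply: avg_blocks => // y yt.
    by apply: deg2 => //; have := tD y yt; rewrite mem_enum.
have : avg D list_size (fun l => (L l)%:R) <= avg D list_size (fun l =>
   (linked X l)%:R + ((~~ uniq l)%:R + (has (mem X) l)%:R)) :> K.
  apply: avg_le => l _ _; rewrite -!natrD ler_nat; case: l => // h l'.
  rewrite /L /linked andbA cat_uniq uX; case: (blocks _ _ _ _ && _) => //.
  by case: (has _ _); case: (uniq _).
rewrite !avgD.
have hU := avg_nuniq K list_size D0 (enum_uniq _).
have hX := avg_hit K (mem X) list_size D0.
have cX : (count (mem X) D <= m)%N.
  rewrite -sX -size_filter; apply: uniq_leq_size; first by rewrite filter_uniq ?enum_uniq.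
  by move=> x; rewrite mem_filter => /andP[].
have hX' : list_size%:R * (count (mem X) D)%:R / (size D)%:R <=
    list_size%:R * m%:R / n%:R :> K.
  by rewrite sD ler_wpM2r ?invr_ge0 // ler_wpM2l // ler_nat.
have hs : list_size%:R ^+ 2 / (size D)%:R + list_size%:R * m%:R / n%:R <=
    p ^+ (m.+1 + hub_size) / 2%:R.
  rewrite sD -mulrDl ler_pdivrMr // [leRHS]mulrAC ler_pdivlMr ?ltr0n //.
  rewrite /p exprVn [leRHS]mulrC ler_pdivlMr ?exprn_gt0 ?ltr0n //.
  rewrite -!natrX -natrM -natrD -!natrM ler_nat; apply: leq_trans big.
  rewrite leq_mul2r -mulnn; apply/orP; right; lia.
lra.
Qed.

(** Together with [Cov] this puts every entry of the list on an edge inside the list, which makes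
    all the degrees of the absorber positive. *)
Lemma linked_cover (X l : seq T) v : linked X l -> size l = list_size -> v \in l ->
  exists S, [/\ v \in S, {subset S <= l} & PG S].
Proof.
case: l => // h l' /and3P[b1 b2 _] [sl].
have shub : size (take hub_size l') = hub_size by rewrite size_takel ?sl ?leq_addr.
rewrite inE -{1}(cat_take_drop hub_size l') mem_cat => /or3P[/eqP ->|vt|vd].
- have [|t tl Pt] := blocksP b1 (x := h); first by rewrite inE eqxx.
  exists (h :: t); split; rewrite ?inE ?eqxx // => x; rewrite !inE.
  by case/predU1P => [->|/tl/mem_take ->]; rewrite ?eqxx ?orbT.
- have [t tl /andP[Pt _]] := blocksP b2 vt.
  exists (v :: t); split; rewrite ?inE ?eqxx // => x; rewrite !inE.
  by case/predU1P => [->|/tl/mem_drop ->]; rewrite ?(mem_take vt) ?orbT.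
- have [|x [t [xt vt tl /andP[Pt _]]]] := blocks_mem b2 _ vd.
    by rewrite size_drop sl shub addKn.
  exists (x :: t); split; rewrite ?inE ?vt ?orbT // => y; rewrite !inE.
  by case/predU1P => [->|/tl/mem_drop ->]; rewrite ?(mem_take xt) ?orbT.
Qed.

Lemma PG_Cov S v : PG S -> v \in S ->
  exists e, [/\ e \in edges H, {subset e <= S} & mult v e = 1%N].
Proof.
move=> /in_property_graphP[_ _ _ [_ C]] vS.
have [|e] := C v; first by rewrite inE.
rewrite inE => /andP[eH /forallP eS] ve; exists e; split=> // x /tnthP[i ->].
by have := eS i; rewrite inE.
Qed.

(** The multisets [es] and [es'] have equal degrees on [l], while [es'] also has degree 1 on [X].
    They come from writing the sum of the vectors [a_x] over [X] as a difference of edges inside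
    [l]. *)
Lemma linked_absorbs (X l : seq T) : linked X l -> size l = list_size -> size X = m ->
  exists es es' : seq (m.-tuple T),
    [/\ forall e, e \in es -> e \in edges H /\ {subset e <= l},
        forall e, e \in es' -> e \in edges H /\ {subset e <= X ++ l},
        forall x, x \in X -> (\sum_(e <- es') mult x e = 1)%N,
        forall v, v \in l -> (\sum_(e <- es) mult v e = \sum_(e <- es') mult v e)%N
      & forall v, v \in l -> (0 < \sum_(e <- es) mult v e)%N].
Proof.
move=> lk sl sX; have cov := linked_cover lk sl.
case: l => // h l' in lk sl cov *; have /and3P[b1 b2 uXl] := lk.
set l := h :: l' in uXl cov *; set hub := take hub_size l' in b1 b2.
have hub_l x : x \in hub -> x \in l by move=> /mem_take; rewrite inE orbC => ->.
have hl : h \in l by rewrite inE eqxx.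
move: (uXl); rewrite cat_uniq => /and3P[uX XNl ul].
have XNl' x : x \in X -> x \notin l.
  by move=> xX; apply/negP => xl; case/hasP: XNl; exists x.
(* The sets [t + s] and [h + s] share the block [s], so subtracting their indicators, both in the
   lattice by [Div], leaves [1_t - 1_h]. *)
have diff t : t \in hub -> edge_lattice H l (fun v => (v == t)%:R - (v == h)%:R).
  move=> thub; have [s sl' /andP[P1 P2]] := blocksP b2 thub.
  have sub y : y \in l -> {subset y :: s <= l}.
    move=> yl z; rewrite inE => /predU1P[->//|/sl'/mem_drop zl].
    by rewrite inE zl orbT.
  have [/= /andP[ts _] _ _ [D1 _]] := in_property_graphP P1.
  have [/= /andP[hs _] _ _ [D2 _]] := in_property_graphP P2.
  have := edge_latticeB (edge_lattice_Div (sub t (hub_l t thub)) D1)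
                        (edge_lattice_Div (sub h hl) D2).
  apply: edge_lattice_ext => v; rewrite !inE.
  have [->|vt] := eqVneq v t; have [vh|vh] := eqVneq _ h.
  - by rewrite subrr.
  - by rewrite (negbTE ts) subr0.
  - by rewrite vh (negbTE hs).
  - by rewrite /= subrr subr0.
have /choice[ex exP] x : exists e : m.-tuple T, x \in h :: X ->
   [/\ e \in edges H, {subset e <= x :: hub} & mult x e = 1%N].
  case: (boolP (x \in h :: X)) => [xX|]; last first.
    by move=> _; exists [tuple of nseq m h].
  have [s shub Ps] := blocksP b1 xX.
  have [|e [eH es me]] := PG_Cov Ps (v := x); first by rewrite inE eqxx.
  exists e => _; split=> // y /es; rewrite !inE => /predU1P[->|/shub ->].
    by rewrite eqxx.
  by rewrite orbT.
(* Apart from its single [x], the edge [ex x] has [m - 1] entries, all in the hub blocks; each is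
   moved to [h] by [diff]. *)
have part x : x \in h :: X -> edge_lattice H l
    (fun v => (mult v (ex x))%:R - (v == x)%:R - (m.-1)%:R * (v == h)%:R).
  move=> xX; have [eH esub me] := exP x xX.
  have : edge_lattice H l (fun v => \sum_(t | t != x)
      (mult t (ex x))%:Z * ((v == t)%:R - (v == h)%:R)).
    apply: edge_lattice_sum => t _ tx; have [th|th] := boolP (t \in hub).
      exact/edge_latticeZ/diff.
    apply: edge_lattice_ext (edge_lattice0 H l) => v.
    rewrite mult_notin ?mul0r //; apply/negP => /esub.
    by rewrite inE (negbTE tx) (negbTE th).
  apply: edge_lattice_ext => v; under eq_bigr do rewrite mulrBr.
  rewrite sumrB -mulr_suml; congr (_ - _ * _); last first.
    have <- : (\sum_(t | t != x) mult t (ex x) = m.-1)%N.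
      by have := sum_mult (ex x); rewrite (bigD1 x) //= me; lia.
    by rewrite natr_sum; apply: eq_bigr => t _; rewrite natz.
  have [->|vx] := eqVneq v x.
    rewrite me subrr big1 // => t; rewrite eq_sym => /negbTE ->; exact: mulr0.
  rewrite subr0 (bigD1 v) //= eqxx mulr1 big1 ?addr0 ?natz // => t /andP[_].
  by rewrite eq_sym => /negbTE ->; exact: mulr0.
(* For [x = h] the edge [ex h] lies inside [l], so subtracting [part h] from it leaves [m] copies of
   [1_h]. *)
have hubm : edge_lattice H l (fun v => m%:R * (v == h)%:R).
  have hX : h \in h :: X by rewrite inE eqxx.
  have [eH esub me] := exP h hX.
  have eL : edge_lattice H l (fun v => (mult v (ex h))%:R).
    apply: edge_lattice_edge => // x /esub; rewrite inE => /predU1P[->//|].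
    exact: hub_l.
  apply: edge_lattice_ext (edge_latticeB eL (part h hX)) => v.
  have -> : m%:R = 1 + (m.-1)%:R :> int by rewrite -{1}(@prednK m) ?natr1 1?addrC //; lia.
  ring.
(* Summing [part] over the [m] elements of [X] leaves [m (m - 1)] copies of [1_h] to be corrected,
   which is [m - 1] times [hubm]. *)
have : edge_lattice H l (fun v => \sum_(x <- X) ((mult v (ex x))%:R - (v == x)%:R)).
  have p1 : edge_lattice H l (fun v => \sum_(x <- X)
      ((mult v (ex x))%:R - (v == x)%:R - (m.-1)%:R * (v == h)%:R)).
    by apply: edge_lattice_sum => x xX _; apply: part; rewrite inE xX orbT.
  apply: edge_lattice_ext (edge_latticeD p1 (edge_latticeZ (m.-1)%:R hubm)) => v.
  rewrite sumrB big_const_seq iter_addr_0 count_predT sX -[_ *+ m]mulr_natl.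
  ring.
move=> [p [q [pq uE]]].
have pqNX x e : e \in p ++ q -> x \in X -> mult x e = 0%N.
  move=> /pq[_ el] xX; apply: mult_notin; apply/negP => /el.
  by apply/negP; exact: XNl'.
(* All edges inside [l] are added to both sides; this preserves the balance and makes every degree
   on [l] positive. *)
pose B := enum [set e in edges H | [forall i, tnth e i \in l]].
have BP e : e \in B -> e \in edges H /\ {subset e <= l}.
  rewrite mem_enum inE => /andP[eH /forallP el]; split=> // x /tnthP[i ->].
  exact: el.
exists (B ++ p), (B ++ q ++ map ex X); split.
- move=> e; rewrite mem_cat => /orP[/BP//|ep]; apply: pq.
  by rewrite mem_cat ep.
- move=> e; rewrite !mem_cat => /or3P[/BP[eH el]|eQ|/mapP[x xX ->]].
  + by split=> // y /el yl; rewrite mem_cat yl orbT.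
  + have [|eH el] := pq e; first by rewrite mem_cat eQ orbT.
    by split=> // y /el yl; rewrite mem_cat yl orbT.
  + have [|eH el _] := exP x; first by rewrite inE xX orbT.
    split=> // y /el; rewrite mem_cat inE => /predU1P[->|/hub_l ->]; first by rewrite xX.
    by rewrite orbT.
- move=> x xX; rewrite !big_cat /= big_map.
  have zero (s : seq (m.-tuple T)) : (forall e, e \in s -> mult x e = 0%N) ->
      (\sum_(e <- s) mult x e = 0)%N.
    by move=> h0; rewrite big_seq big1.
  rewrite (zero B) ?(zero q) ?add0n //; first last.
  + move=> e /BP[_ el]; apply: mult_notin; apply/negP => /el.
    by apply/negP; exact: XNl'.
  + by move=> e eQ; apply: pqNX => //; rewrite mem_cat eQ orbT.
  have := uE x; rewrite -!natr_sum zero; last first.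
    by move=> e ep; apply: pqNX => //; rewrite mem_cat ep.
  rewrite zero; last by move=> e eQ; apply: pqNX => //; rewrite mem_cat eQ orbT.
  rewrite subrr sumrB -!natr_sum => /eqP; rewrite subr_eq0 eqr_nat => /eqP ->.
  rewrite (bigD1_seq x) //= eqxx big1 // => y; rewrite eq_sym.
  by move=> /negbTE ->.
- move=> v vl; rewrite !big_cat /=; congr (_ + _)%N.
  have := uE v; rewrite sumrB -!natr_sum big_map.
  rewrite [X in _ - X%:R](_ : _ = 0)%N; last first.
    rewrite big_seq big1 // => x xX; case: eqP => // vx.
    by have := XNl' x xX; rewrite -vx vl.
  rewrite subr0 => /eqP; rewrite eq_sym subr_eq -natrD eqr_nat addnC => /eqP ->.
  by [].
- move=> v vl; have [S [vS Sl PS]] := cov v vl; have [e [eH eS me]] := PG_Cov PS vS.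
  rewrite big_cat /= addn_gt0; apply/orP; left.
  rewrite (big_rem e) /=; first by rewrite me.
  rewrite mem_enum inE eH; apply/forallP => i; apply: Sl; apply: eS.
  exact: mem_tnth.
Qed.

End AbsorbingList.

(** * Absorbing patterns and their blow-ups *)

Section AbsorbPattern.
Variables (m k : nat).

(* [inl i] stands for the [i]-th vertex to be absorbed and [inr z] for the [z]-th
   entry of a list to be blown up: [fs] will match the blown-up list alone, [fs']
   the blown-up list together with the absorbed vertices. *)
Definition absorb_pattern (N : nat) (R : {set m.-tuple ('I_m + 'I_k)}) : Prop :=
  exists fs fs' : seq (m.-tuple ('I_m + 'I_k)),
    [/\ size fs = N, {subset fs ++ fs' <= R},
        forall i, \sum_(f <- fs) mult (inl i) f = 0%N /\
                  \sum_(f <- fs') mult (inl i) f = 1%N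
      & forall z, (0 < \sum_(f <- fs) mult (inr z) f)%N /\
                  \sum_(f <- fs) mult (inr z) f = \sum_(f <- fs') mult (inr z) f].

(** Both multisets are padded with copies of one edge of [fs], which contains no absorbed vertex. *)
Lemma absorb_pattern_mono N N' R : (0 < k)%N -> (N <= N')%N ->
  absorb_pattern N R -> absorb_pattern N' R.
Proof.
move=> k0 NN' [fs [fs' [sfs fsR fsl fsr]]].
have [f0 f0fs] : exists f, f \in fs.
  case: fs fsr {sfs fsR fsl} => [/(_ (Ordinal k0))[]|f fs _]; first by rewrite big_nil.
  by exists f; rewrite inE eqxx.
have f0l i : mult (inl i) f0 = 0%N.
  have [] := fsl i; rewrite (big_rem f0) //= => /eqP.
  by rewrite addn_eq0 => /andP[/eqP].
exists (nseq (N' - N) f0 ++ fs), (nseq (N' - N) f0 ++ fs'); split.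
- by rewrite size_cat size_nseq sfs subnK.
- move=> f; rewrite !mem_cat !mem_nseq => /orP[]/orP[] => [/andP[_ /eqP ->]|h|/andP[_ /eqP ->]|h];
    by apply: fsR; rewrite mem_cat ?f0fs ?h ?orbT.
- move=> i; have [h h'] := fsl i.
  by rewrite !big_cat /= big_nseq iter_addn_0 f0l mul0n h h'.
- move=> z; have [h h'] := fsr z.
  by rewrite !big_cat /= h' addn_gt0 -h' h orbT.
Qed.

(** There are finitely many patterns [R], so one [N], independent of [H], serves them all. Hence all
    absorbers have the same length [m * N]. *)
Lemma absorb_pattern_bound : (0 < k)%N ->
  exists N, forall R N0, absorb_pattern N0 R -> absorb_pattern N R.
Proof.
move=> k0; have /choice[g gP] R : exists N, forall N0, absorb_pattern N0 R ->
    absorb_pattern N R.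
  have [[N RN]|nR] := pselect (exists N, absorb_pattern N R); first by exists N.
  by exists 0%N => N0 RN0; case: nR; exists N0.
exists (\max_R g R) => R N0 /gP; apply: absorb_pattern_mono => //.
exact: leq_bigmax.
Qed.

End AbsorbPattern.

Section LinkedPattern.
Variables (m k : nat) (T : finType) (H : mdigraph m T) (x0 : T) (X : seq T).

Definition vertex (l : seq T) (u : 'I_m + 'I_k) : T :=
  match u with inl i => nth x0 X i | inr z => nth x0 l z end.

Definition list_pattern (l : seq T) : {set m.-tuple ('I_m + 'I_k)} :=
  [set f : m.-tuple ('I_m + 'I_k) | [tuple of map (vertex l) f] \in edges H].

Hypotheses (m0 : (0 < m)%N) (k0 : (0 < k)%N) (sX : size X = m).

Lemma linked_absorb_pattern l : size l = k -> uniq (X ++ l) ->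
  (exists es es' : seq (m.-tuple T),
    [/\ forall e, e \in es -> e \in edges H /\ {subset e <= l},
        forall e, e \in es' -> e \in edges H /\ {subset e <= X ++ l},
        forall x, x \in X -> (\sum_(e <- es') mult x e = 1)%N,
        forall v, v \in l -> (\sum_(e <- es) mult v e = \sum_(e <- es') mult v e)%N
      & forall v, v \in l -> (0 < \sum_(e <- es) mult v e)%N]) ->
  exists N, absorb_pattern N (list_pattern l).
Proof.
move=> sl; rewrite cat_uniq => /and3P[uX XNl ul] [es [es' [esH es'H es'X esl es0]]].
pose idx x : 'I_m + 'I_k := if x \in X then inl (insubd (Ordinal m0) (index x X))
  else inr (insubd (Ordinal k0) (index x l)).
have idxK x : x \in X ++ l -> vertex l (idx x) = x.
  rewrite mem_cat /idx; case: ifP => /= [xX _|_ xl].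
    have xm : (index x X < m)%N by rewrite -[X in (_ < X)%N]sX index_mem.
    by rewrite insubdK ?nth_index.
  have xk : (index x l < k)%N by rewrite -[X in (_ < X)%N]sl index_mem.
  by rewrite insubdK ?nth_index.
have vertexK u : idx (vertex l u) = u.
  case: u => i; rewrite /idx /=.
    rewrite mem_nth ?sX // index_uniq ?sX //; congr inl.
    by apply: val_inj; rewrite insubdK //; exact: ltn_ord.
  have il : nth x0 l i \in l by rewrite mem_nth ?sl.
  rewrite ifN; last by apply/negP => iX; case/hasP: XNl; exists (nth x0 l i).
  rewrite index_uniq ?sl //; congr inr.
  by apply: val_inj; rewrite insubdK //; exact: ltn_ord.
have mE u (e : m.-tuple T) : {subset e <= X ++ l} ->
    mult u [tuple of map idx e] = mult (vertex l u) e.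
  move=> eXl; rewrite !mult_count count_map; apply: eq_in_count => x xe /=.
  by apply/eqP/eqP => [<-|->]; rewrite ?idxK ?vertexK ?eXl.
have sub e : e \in es -> {subset e <= X ++ l}.
  by move=> /esH[_ h] x /h xl; rewrite mem_cat xl orbT.
have mes u : \sum_(f <- [seq [tuple of map idx (val e)] | e : m.-tuple T <- es]) mult u f =
    \sum_(e <- es) mult (vertex l u) e.
  by rewrite big_map big_seq [RHS]big_seq; apply: eq_bigr => e ees; exact: mE (sub e ees).
have mes' u : \sum_(f <- [seq [tuple of map idx (val e)] | e : m.-tuple T <- es']) mult u f =
    \sum_(e <- es') mult (vertex l u) e.
  rewrite big_map big_seq [RHS]big_seq; apply: eq_bigr => e ees.
  by apply: mE; case: (es'H e ees).
exists (size es), [seq [tuple of map idx (val e)] | e : m.-tuple T <- es],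
  [seq [tuple of map idx (val e)] | e : m.-tuple T <- es']; split.
- by rewrite size_map.
- have inR (e : m.-tuple T) : e \in edges H -> {subset e <= X ++ l} ->
      [tuple of map idx e] \in list_pattern l.
    move=> eH eXl; rewrite inE; set g := (X in X \in _); suff -> : g = e by [].
    apply: val_inj => /=; rewrite -map_comp -[RHS]map_id; apply/eq_in_map => x xe /=.
    exact/idxK/eXl.
  move=> f; rewrite mem_cat => /orP[]/mapP[e ein ->].
    by apply: inR; [case: (esH e ein) | exact: sub].
  by case: (es'H e ein) => *; apply: inR.
- move=> i; rewrite mes mes' /= es'X ?mem_nth ?sX //; split=> //.
  rewrite big_seq big1 // => e /esH[_ el]; apply: mult_notin.
  by apply/negP => /el il; case/hasP: XNl; exists (nth x0 X i); rewrite ?mem_nth ?sX.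
- by move=> z; rewrite mes mes' es0 ?esl ?mem_nth ?sl.
Qed.

Definition absorbs (W : seq T) : Prop :=
  [/\ uniq (X ++ W), matchable H [set x in W] & matchable H [set x in X ++ W]].

Hypotheses (fH : fissile H) (XH : {subset X <= verts H}).

(** Part [z] has as many vertices as the common degree of [inr z] in [fs] and [fs']. So
    [matchable_blowup] applies to [fs] with nothing at the absorbed vertices, and to [fs'] with one
    vertex at each. *)
Lemma pattern_absorbs (R : {set m.-tuple ('I_m + 'I_k)}) fs fs' ts :
  {subset fs ++ fs' <= R} ->
  (forall i, \sum_(f <- fs) mult (inl i) f = 0%N /\
             \sum_(f <- fs') mult (inl i) f = 1%N) ->
  (forall z, (0 < \sum_(f <- fs) mult (inr z) f)%N /\
             \sum_(f <- fs) mult (inr z) f = \sum_(f <- fs') mult (inr z) f) ->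
  map size ts = [seq (\sum_(f <- fs) mult (inr z) f)%N | z <- enum 'I_k] ->
  (forall t, t \in ts -> {subset t <= verts H}) ->
  transversals (fun l => list_pattern l == R) ts ->
  uniq (X ++ flatten ts) -> absorbs (flatten ts).
Proof.
move=> fsR fsl fsr sts tsH tr uXW; move: (uXW); rewrite cat_uniq => /and3P[uX XNW uW].
have szts : size ts = k by rewrite -(size_map size) sts size_map size_enum_ord.
have szt (z : 'I_k) : size (nth [::] ts z) = (\sum_(f <- fs) mult (inr z) f)%N.
  by rewrite -(nth_map _ 0%N) ?szts // sts (nth_map z) ?size_enum_ord // nth_ord_enum.
have ut (z : 'I_k) : uniq (nth [::] ts z).
  have : uniq (flatten (take z ts ++ drop z ts)) by rewrite cat_take_drop.
  rewrite (drop_nth [::]) ?szts // flatten_cat cat_uniq /= cat_uniq.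
  by case/and3P => _ _ /and3P[].
have VW x : x \in flatten ts -> exists z : 'I_k, x \in nth [::] ts z.
  by case/flattenP => t /(nthP [::])[z]; rewrite szts => zk <- xz; exists (Ordinal zk).
have WV (z : 'I_k) x : x \in nth [::] ts z -> x \in flatten ts.
  by move=> xz; apply/flattenP; exists (nth [::] ts z) => //; rewrite mem_nth ?szts.
have VH (z : 'I_k) : {subset nth [::] ts z <= verts H}.
  by apply: tsH; rewrite mem_nth ?szts.
(* Stated for any parts inside the singletons of [X], so that it serves both the empty parts used
   with [fs] and the singletons used with [fs']. *)
have strict (V : 'I_m + 'I_k -> {set T}) f : f \in R ->
    (forall i, V (inl i) \subset [set nth x0 X i]) ->
    (forall z, V (inr z) = [set x in nth [::] ts z]) ->
    forall e, strictly_preserving V f e -> e \in edges H.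
  move=> fR Vl Vr e /andP[/forallP pe /forallP se].
  have /choice[g gP] (j : nat) : exists x, (j < k)%N -> x \in nth [::] ts j /\
      forall a (z : 'I_k), val z = j -> tnth f a = inr z -> tnth e a = x.
    have [jk|jk] := ltnP j k; last by exists x0.
    have [a /eqP aj|na] := pickP (fun a => tnth f a == inr (Ordinal jk)).
      exists (tnth e a) => _; split; first by have := pe a; rewrite aj Vr inE.
      move=> a' z zj fa'; apply/eqP; move/forallP: (se a') => /(_ a)/implyP; apply.
      by rewrite aj fa'; apply/eqP; congr inr; exact: val_inj.
    (* A part that [f] does not meet still needs a representative; it is non-empty because degrees
       are positive. *)
    exists (nth x0 (nth [::] ts j) 0) => _; split.
      by rewrite mem_nth // (szt (Ordinal jk)); case: (fsr (Ordinal jk)).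
    by move=> a z zj fa; have := na a; rewrite fa => /eqP[]; congr inr; exact: val_inj.
  have /eqP Rl : list_pattern (mkseq g k) == R.
    apply: (transversalsP (x0 := x0) tr); first by rewrite size_mkseq szts.
    by move=> j; rewrite szts => jk; rewrite nth_mkseq //; case: (gP j jk).
  move: fR; rewrite -Rl inE; set h := (X in X \in _); suff -> : h = e by [].
  apply: eq_from_tnth => a; rewrite tnth_map; have := pe a.
  case fa : (tnth f a) => [i|z] /=.
    by move=> /(subsetP (Vl i)); rewrite inE => /eqP ->.
  move=> _; rewrite nth_mkseq //; case: (gP z (ltn_ord z)) => _ h'.
  by rewrite (h' a z).
have cV (z : 'I_k) : #|[set x in nth [::] ts z]| = (\sum_(f <- fs) mult (inr z) f)%N.
  by rewrite cardsE -szt; apply/card_uniqP.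
have dV (z z' : 'I_k) : z != z' ->
    [disjoint [set x in nth [::] ts z] & [set x in nth [::] ts z']].
  move=> nz; apply/pred0P => x /=; rewrite !inE; apply/negP => /andP[xz xz'].
  by case/eqP: nz; apply: val_inj; exact: nth_flatten_inj uW xz xz'.
split=> //.
- have -> : [set x in flatten ts] = \bigcup_(u : 'I_m + 'I_k)
     (if u is inr z then [set x in nth [::] ts z] else set0).
    apply/setP => x; rewrite inE; apply/idP/bigcupP => [/VW[z xz]|[[i|z] _]].
    - by exists (inr z); rewrite ?inE.
    - by rewrite inE.
    - by rewrite inE => /WV.
  apply: (matchable_blowup fH (fs := fs) m0).
  + case=> [i|z]; first exact: sub0set.
    by apply/subsetP => x; rewrite inE; exact: VH.
  + by case=> [i|z] [j|z'] nuv; rewrite -setI_eq0 ?set0I ?setI0 // setI_eq0 dV.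
  + move=> f ffs; apply: strict => // [|i]; first by apply: fsR; rewrite mem_cat ffs.
    exact: sub0set.
  + by case=> [i|z]; rewrite ?cV // cards0; case: (fsl i).
- have -> : [set x in X ++ flatten ts] = \bigcup_(u : 'I_m + 'I_k)
     (match u with inr z => [set x in nth [::] ts z] | inl i => [set nth x0 X i] end).
    apply/setP => x; rewrite inE mem_cat; apply/orP/bigcupP => [[]|[[i|z] _]].
    - move=> /(nthP x0)[i]; rewrite sX => im <-; exists (inl (Ordinal im)) => //.
      by rewrite inE.
    - by move=> /VW[z xz]; exists (inr z); rewrite ?inE.
    - by rewrite inE => /eqP ->; left; rewrite mem_nth ?sX.
    - by rewrite inE => /WV; right.
  have XNt (i : 'I_m) (z : 'I_k) : nth x0 X i \notin nth [::] ts z.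
    apply/negP => /WV iW; case/hasP: XNW; exists (nth x0 X i) => //.
    by rewrite mem_nth ?sX.
  apply: (matchable_blowup fH (fs := fs') m0).
  + case=> [i|z]; first by rewrite sub1set; apply: XH; rewrite mem_nth ?sX.
    by apply/subsetP => x; rewrite inE; exact: VH.
  + case=> [i|z] [j|z'] nuv; last exact: dV.
    * rewrite disjoints1 inE; apply: contra nuv => /eqP/eqP.
      by rewrite nth_uniq ?sX // => /eqP/val_inj ->.
    * by rewrite disjoints1 inE XNt.
    * by rewrite disjoint_sym disjoints1 inE XNt.
  + move=> f ffs; apply: strict => //; by apply: fsR; rewrite mem_cat ffs orbT.
  + case=> [i|z]; first by rewrite cards1; case: (fsl i).
    by rewrite cV; case: (fsr z).
Qed.

End LinkedPattern.

Lemma prod_le_exp (bs : seq nat) w : (forall b, b \in bs -> b <= w)%N ->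
  (\prod_(b <- bs) b <= w ^ size bs)%N.
Proof.
elim: bs => [|b bs IH] bw; first by rewrite big_nil.
rewrite big_cons expnS leq_mul ?bw ?inE ?eqxx // IH // => b' b's.
by apply: bw; rewrite inE b's orbT.
Qed.

(** Linked lists are dense, so one absorbing pattern is dense among them; its blow-ups are then
    dense by [avg_blowup], and each blow-up disjoint from [X] and without repetition absorbs [X]. *)
Lemma absorb_density (K : realType) (m r : nat) : (2 <= m)%N -> (m <= r)%N ->
  exists (c : K) (N n1 : nat), [/\ 0 < c, c <= 1 &
    forall (T : finType) (H : mdigraph m T), (n1 <= #|verts H|)%N -> fissile H ->
      robustly K r (fun G => Div G /\ Cov G) H ->
      forall X, uniq X -> {subset X <= verts H} -> size X = m ->
      c <= avg (enum (verts H)) (m * N) (fun W => `[< absorbs H X W >]%:R)].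
Proof.
move=> m2 mr; have m0 : (0 < m)%N by lia.
set k := list_size m r; have k0 : (0 < k)%N by [].
have [N NP] := absorb_pattern_bound m k0; set w := (m * N)%N.
pose Q := {set m.-tuple ('I_m + 'I_k)}.
pose c1 : K := (4%:R^-1 ^+ (m.+1 + hub_size m r)) / 2%:R.
have c1_gt0 : 0 < c1 by rewrite divr_gt0 // exprn_gt0 // invr_gt0.
have c1_le1 : c1 <= 1.
  have e1 : 4%:R^-1 ^+ (m.+1 + hub_size m r) <= 1 :> K.
    by rewrite exprn_ile1 ?invr_ge0 // invf_le1 // ler1n.
  rewrite /c1; lra.
have Q0 : (0 < #|{: Q}|)%N by apply/card_gt0P; exists set0.
pose d : K := c1 / #|{: Q}|%:R.
have d_gt0 : 0 < d by rewrite divr_gt0 // ltr0n.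
have d_le1 : d <= 1.
  by rewrite ler_pdivrMr ?ltr0n // mul1r (le_trans c1_le1) // ler1n.
(* All [k] parts have size at most [w], so the exponent [w ^ k] works for every pattern. Half of the
   density is given up for repetitions and for lists meeting [X]. *)
pose c : K := d ^+ (w ^ k) / 2%:R.
have c_gt0 : 0 < c by rewrite divr_gt0 // exprn_gt0.
have c_le1 : c <= 1.
  have e1 : d ^+ (w ^ k) <= 1 by rewrite exprn_ile1 // ltW.
  by rewrite /c; lra.
pose Y : K := (w%:R ^+ 2 + w%:R * m%:R) / c.
have Y0 : 0 <= Y by apply: divr_ge0; [rewrite addr_ge0 ?exprn_ge0 ?mulr_ge0 | exact: ltW].
exists c, N, (2 * k * (k + m) * 4 ^ (m.+1 + hub_size m r) + (Num.bound Y))%N.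
split=> // T H nH fH rob X uX XH sX; rewrite -/w; set D := enum _.
have sD : size D = #|verts H| by rewrite -cardE.
have YH : Y <= #|verts H|%:R.
  apply: le_trans (ltW (archi_boundP Y0)) _; rewrite ler_nat.
  exact: leq_trans (leq_addl _ _) nH.
have [x0 x0X] : exists x0, x0 \in X.
  by case: (X) sX => [/= e|x s _]; [move: m0; rewrite -e | exists x; rewrite inE eqxx].
have n0 : (0 < #|verts H|)%N by apply/card_gt0P; exists x0; exact: XH.
have nK : 0 < #|verts H|%:R :> K by rewrite ltr0n.
have D0 : (0 < size D)%N by rewrite sD.
have lk := linked_density m2 mr rob uX XH sX (leq_trans (leq_addr _ _) nH).
have [|R /asboolP RN dR] := avg_pigeonhole (col := list_pattern k H x0 X)
   (good := fun R => `[< absorb_pattern N R >]) c1_gt0 _ lk.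
  move=> l sl lD lkl; apply/asboolP.
  have uXl : uniq (X ++ l) by case: (l) lkl => // h l' /and3P[].
  have [N0 /NP//] := linked_absorb_pattern x0 m0 k0 sX sl uXl
    (linked_absorbs m2 mr lkl sl sX).
have [fs [fs' [sfs fsR fsl fsr]]] := RN.
pose bs := [seq (\sum_(f <- fs) mult (inr z) f)%N | z : 'I_k <- enum 'I_k].
have sbs : size bs = k by rewrite size_map size_enum_ord.
(* The [N] edges of [fs] have no entry at an absorbed vertex, so all their [m * N] entries are
   counted by the parts. *)
have sumbs : sumn bs = w.
  rewrite sumnE big_map big_enum /= exchange_big /=.
  have h : (\sum_(f <- fs) \sum_(i : 'I_m) mult (inl i) f = 0)%N.
    by rewrite exchange_big /= big1 // => i _; case: (fsl i).
  have : (\sum_(f <- fs) \sum_(i : 'I_m) mult (inl i) f +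
      \sum_(f <- fs) \sum_(z : 'I_k) mult (inr z) f = \sum_(f <- fs) m)%N.
    by rewrite -big_split; apply: eq_bigr => f _; rewrite -[RHS](sum_mult f) big_sumType.
  by rewrite h add0n => ->; rewrite big_const_seq count_predT iter_addn_0 sfs.
have bsw b : b \in bs -> (b <= w)%N.
  by move=> bin; rewrite -sumbs sumnE (big_rem b) //= leq_addr.
have d1 : d ^+ (w ^ k) <= avgB D bs (fun ts =>
    (transversals (fun l => list_pattern k H x0 X l == R) ts)%:R).
  apply: le_trans (avg_blowup _ _ _ D0); rewrite sbs.
  apply: le_trans (_ : d ^+ (\prod_(b <- bs) b) <= _).
    apply: ler_wiXn2l => //; first exact: ltW.
    by rewrite -[X in (_ <= _ ^ X)%N]sbs; exact: prod_le_exp.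
  apply: lerXn2r => //; rewrite nnegrE; first exact: ltW.
  exact: le_trans (ltW d_gt0) dR.
have d2 : d ^+ (w ^ k) <= avgB D bs (fun ts =>
    `[< absorbs H X (flatten ts) >]%:R + ((~~ uniq (flatten ts))%:R
      + (has (mem X) (flatten ts))%:R)).
  apply: (le_trans d1); apply: avgB_le => ts sts tsD.
  case tr: (transversals _ _); last by apply: addr_ge0 => //; exact: addr_ge0.
  case uW: (uniq (flatten ts)); last by rewrite /= addrA addrAC lerDr; apply: addr_ge0.
  case hW: (has (mem X) (flatten ts)); first by rewrite /= add0r lerDr.
  suff /asboolP -> : absorbs H X (flatten ts) by rewrite !addr0.
  apply: (pattern_absorbs m0 sX fH XH fsR fsl fsr sts _ tr).
    by move=> t /tsD tD x /tD; rewrite mem_enum.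
  by rewrite cat_uniq uX hW uW.
rewrite (avgB_flatten D bs (fun W => `[< absorbs H X W >]%:R + ((~~ uniq W)%:R
      + (has (mem X) W)%:R))) sumbs !avgD in d2.
have hU := avg_nuniq K w D0 (enum_uniq _).
have hX := avg_hit K (mem X) w D0.
have cX : (count (mem X) D <= m)%N.
  rewrite -sX -size_filter; apply: uniq_leq_size; first by rewrite filter_uniq ?enum_uniq.
  by move=> x; rewrite mem_filter => /andP[].
have hX' : w%:R * (count (mem X) D)%:R / (size D)%:R <= w%:R * m%:R / (size D)%:R :> K.
  by rewrite ler_wpM2r ?invr_ge0 // ler_wpM2l // ler_nat.
have hs : w%:R ^+ 2 / (size D)%:R + w%:R * m%:R / (size D)%:R <= c :> K.
  by rewrite -mulrDl sD ler_pdivrMr // [leRHS]mulrC -ler_pdivrMr.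
have cc : d ^+ (w ^ k) = c + c by rewrite /c; field.
lra.
Qed.

(** * Choosing a family of disjoint absorbers *)

Section Selection.
Variables (K : realFieldType) (C : eqType) (D : seq C).

Lemma avg_single k (F : seq C -> K) l : (forall l, 0 <= F l) ->
  size l = k -> {subset l <= D} -> F l <= (size D)%:R ^+ k * avg D k F.
Proof.
elim: k F l => [|k IH] F l F0; first by move=> /size0nil ->; rewrite expr0 mul1r.
case: l => // x l [sl] lD; rewrite avgS exprS.
have xD : x \in D by apply: lD; rewrite inE eqxx.
have D0 : (size D)%:R != 0 :> K by rewrite pnatr_eq0; case: (D) xD.
set S := \sum_(x <- D) _; rewrite [leRHS](_ : _ = (size D)%:R ^+ k * S); last by field.
apply: le_trans (IH (fun l => F (x :: l)) l _ sl _) _ => // [y yl|].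
  by apply: lD; rewrite inE yl orbT.
rewrite ler_wpM2l ?exprn_ge0 // /S (big_rem x) //= lerDl sumr_ge0 // => y _.
exact: avg_ge0.
Qed.

Variables (m w : nat) (rel : seq C -> seq C -> bool) (c : K).
Hypotheses (D0 : (0 < size D)%N) (uD : uniq D) (c0 : 0 < c) (c1 : c <= 1).
Hypothesis rel_dense : forall X, uniq X -> {subset X <= D} -> size X = m ->
  c <= avg D w (fun W => (rel X W)%:R).
Hypothesis rel_uniq : forall X W, rel X W -> uniq W.

(** Each absorber of [X] halves the weight of [X], so a small total forces every [X] to have many
    absorbers. *)
Definition potential (Ws : seq (seq C)) : K :=
  avg D m (fun X => (uniq X)%:R * 2%:R^-1 ^+ count (rel X) Ws).

(* Greedily minimising the potential replaces the usual random choice of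
   absorbers, with its concentration bounds and union bound over all [X]. *)
Lemma exists_family j : (m ^ 2 < size D)%N ->
  (j * w ^ 2)%:R <= c / 2%:R * (size D)%:R ->
  exists Ws : seq (seq C),
    [/\ size Ws = j, uniq (flatten Ws),
        forall W, W \in Ws -> [/\ size W = w, {subset W <= D} & exists X, rel X W]
      & potential Ws <= (1 - c / 4%:R) ^+ j].
Proof.
move=> big; have DK : 0 < (size D)%:R :> K by rewrite ltr0n.
have [cpos cle1] := (c0, c1).
elim: j => [|j IH] jw.
  exists [::]; split=> //; rewrite expr0 -[1](avg_const D0 m).
  by apply: avg_le => X _ _; rewrite expr0 mulr1 lern1 leq_b1.
have [|Ws [sWs uWs WsP pot]] := IH.
  by apply: le_trans jw; rewrite ler_nat leq_mul.
have sF : size (flatten Ws) = (j * w)%N.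
  rewrite size_flatten /shape -sWs; elim: (Ws) WsP => //= W Ws' IHW WsP.
  rewrite IHW; first by case: (WsP W); rewrite ?inE ?eqxx // => ->.
  by move=> W' W's; apply: WsP; rewrite inE W's orbT.
pose hit W := has (mem (flatten Ws)) W.
pose wt X : K := (uniq X)%:R * 2%:R^-1 ^+ count (rel X) Ws.
have wt0 X : 0 <= wt X by rewrite mulr_ge0 ?exprn_ge0 ?invr_ge0.
(* The weight of the [X] that a new disjoint [W] would absorb. Adding [W] lowers the potential by
   half of it. *)
pose psi W : K := avg D m (fun X => wt X * (rel X W && ~~ hit W)%:R).
(* Positivity makes [psi W] positive for the chosen [W], so that [W] avoids the earlier lists and
   does absorb some [X]. *)
have pot_gt0 : 0 < potential Ws.
  apply: lt_le_trans (_ : 2%:R^-1 ^+ j * avg D m (fun X => (uniq X)%:R) <= _); last first.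
    rewrite -avgZ; apply: avg_le => X _ _; rewrite mulrC ler_wpM2l //.
    rewrite ler_wiXn2l ?invr_ge0 ?invf_le1 ?ler1n //.
    by rewrite -sWs count_size.
  rewrite mulr_gt0 ?exprn_gt0 ?invr_gt0 //.
  have h := avg_nuniq K m D0 uD.
  have h2 : m%:R ^+ 2 / (size D)%:R < 1 :> K.
    by rewrite ltr_pdivrMr // mul1r -natrX ltr_nat.
  have : 1 <= avg D m (fun X => (uniq X)%:R + (~~ uniq X)%:R) :> K.
    rewrite -[leLHS](avg_const D0 m); apply: avg_le => X _ _.
    by case: (uniq X); rewrite /= ?addr0 ?add0r.
  rewrite avgD; lra.
(* Each [X] keeps at least half of its absorber density [c], as a random list meets the earlier ones
   with probability at most [c / 2]. *)
have psi_avg : c / 2%:R * potential Ws <= avg D w psi.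
  rewrite /psi avg_exchange -avgZ; apply: avg_le => X sX XD.
  rewrite avgZ -/(wt X) mulrC; have [uX|uX] := boolP (uniq X); last first.
    by rewrite /wt (negbTE uX) !mul0r.
  rewrite ler_wpM2l //.
  have h1 := rel_dense uX XD sX.
  have h2 : avg D w (fun W => (rel X W)%:R) <=
      avg D w (fun W => (rel X W && ~~ hit W)%:R + (hit W)%:R) :> K.
    by apply: avg_le => W _ _; case: (rel X W); case: (hit W); rewrite /= ?addr0 ?add0r.
  rewrite avgD in h2.
  have h3 := avg_hit K (mem (flatten Ws)) w D0.
  have h4 : w%:R * (count (mem (flatten Ws)) D)%:R / (size D)%:R <= c / 2%:R.
    rewrite ler_pdivrMr //; apply: le_trans jw; rewrite -natrM ler_nat.
    have : (count (mem (flatten Ws)) D <= j * w)%N.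
      rewrite -sF -size_filter; apply: uniq_leq_size; first by rewrite filter_uniq.
      by move=> x; rewrite mem_filter => /andP[].
    move=> hc; apply: leq_trans (leq_mul (leqnn w) hc) _.
    by rewrite mulnCA mulnn leq_mul.
  lra.
have [W [sW WD psiW]] := avg_exists D0 psi_avg.
have psi_gt0 : 0 < psi W.
  by apply: lt_le_trans psiW; rewrite mulr_gt0 // divr_gt0.
have [X [_ _]] := avg_exists D0 (lexx (psi W)).
move=> /(lt_le_trans psi_gt0); case: (boolP (_ && _)) => [/andP[rXW nhit] _|]; last first.
  by rewrite mulr0 ltxx.
exists (W :: Ws); split.
- by rewrite /= sWs.
- by rewrite /= cat_uniq (rel_uniq rXW) uWs andbT; apply: contra nhit;
    case/hasP => x xF xW; apply/hasP; exists x.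
- by move=> W'; rewrite inE => /predU1P[->|/WsP//]; split=> //; exists X.
- apply: le_trans (_ : potential Ws - psi W / 2%:R <= _).
    rewrite /psi mulrC -avgZ -avg_sub; apply: avg_le => X' _ _.
    rewrite -/(wt X') /= exprD mulrCA -/(wt X') (nhit).
    rewrite andbT; case: (rel X' W); rewrite /= ?expr1 ?expr0; lra.
  rewrite exprS; have c4 : 0 <= 1 - c / 4%:R by lra.
  have := ler_wpM2l c4 pot; lra.
Qed.

End Selection.

(** * Absorbing the leftover and assembling the matching *)

Lemma matchable_flatten (m : nat) (T : finType) (H : mdigraph m T) (Ws : seq (seq T)) :
  uniq (flatten Ws) -> (forall W, W \in Ws -> matchable H [set x in W]) ->
  matchable H [set x in flatten Ws].
Proof.
elim: Ws => [|W Ws IH] /= uW mW.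
  rewrite (_ : [set x in [::]] = set0); first exact: matchable0.
  by apply/setP => x; rewrite !inE.
move: uW; rewrite cat_uniq => /and3P[uW WN uWs].
rewrite (_ : [set x in W ++ flatten Ws] = [set x in W] :|: [set x in flatten Ws]).
  apply: matchableU; first by apply: mW; rewrite inE eqxx.
  - by apply: IH => // W' W's; apply: mW; rewrite inE W's orbT.
  - apply/pred0P => x; rewrite /= !inE; apply/negP => /andP[xW xWs].
    by case/hasP: WN; exists x.
by apply/setP => x; rewrite !inE mem_cat.
Qed.

(** The leftover is cut into [g] sets of size [m], absorbed one by one. Each step spends one
    absorber, so [g] absorbers per set are enough at every stage; unspent ones are matched on their
    own. *)
Lemma absorb_all (m : nat) (T : finType) (H : mdigraph m T) g (Ws : seq (seq T))
    (L : seq T) :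
  (0 < m)%N ->
  (forall W, W \in Ws -> matchable H [set x in W]) ->
  uniq (flatten Ws ++ L) -> size L = (g * m)%N ->
  (forall X, uniq X -> {subset X <= L} -> size X = m ->
     (g <= count (fun W => `[< absorbs H X W >]) Ws)%N) ->
  matchable H [set x in flatten Ws ++ L].
Proof.
move=> m0; elim: g Ws L => [|g IH] Ws L mWs uWL sL cnt.
  move: uWL; rewrite (size0nil sL) cats0 => uW.
  exact: matchable_flatten.
pose X := take m L; pose L' := drop m L.
have LE : L = X ++ L' by rewrite cat_take_drop.
have sX : size X = m by rewrite size_takel // sL mulSn leq_addr.
have sL' : size L' = (g * m)%N by rewrite size_drop sL mulSn addKn.
have uL : uniq L by move: uWL; rewrite cat_uniq => /and3P[].
have uX : uniq X by exact: take_uniq.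
have XL : {subset X <= L} by move=> x /mem_take.
have /hasP[W Win /asboolP[_ _ mXW]] : has (fun W => `[< absorbs H X W >]) Ws.
  by rewrite has_count (leq_trans _ (cnt X uX XL sX)).
have pWs := perm_to_rem Win; set Ws' := rem W Ws in pWs.
have pF : perm_eq (flatten Ws ++ L) ((X ++ W) ++ (flatten Ws' ++ L')).
  apply: (@perm_trans _ ((W ++ flatten Ws') ++ L)).
    by rewrite perm_cat2r; apply: (perm_flatten pWs).
  rewrite LE -catA -[X in perm_eq _ X]catA.
  apply: (@perm_trans _ ((flatten Ws' ++ (X ++ L')) ++ W)).
    by rewrite perm_catC.
  rewrite perm_catC catA [X in perm_eq X _]catA perm_sym catA.
  apply/permP => a; rewrite !count_cat; lia.
have -> : [set x in flatten Ws ++ L] = [set x in X ++ W] :|: [set x in flatten Ws' ++ L'].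
  by apply/setP => x; rewrite !inE (perm_mem pF) mem_cat.
move: uWL; rewrite (perm_uniq pF) cat_uniq => /and3P[uXW NW uWL'].
apply: matchableU => //.
- apply: IH => // [W' /mem_rem/mWs//|Y uY YL' sY].
  have YL : {subset Y <= L} by move=> y /YL' /mem_drop.
  have := cnt Y uY YL sY; move/permP: pWs => -> /=.
  by case: (`[< _ >]) => /=; rewrite ?add1n ?add0n ?ltnS // => /ltnW.
- apply/pred0P => x; rewrite /= !inE; apply/negP => /andP[xW xWs].
  by case/hasP: NW; exists x.
Qed.

Lemma fissile_remove (m : nat) (T : finType) (H : mdigraph m T) (A : {set T}) :
  fissile H -> fissile (remove H A).
Proof.
move=> fH U R V Vf [bv be] f fR fa.
have [|e [eH pe ue]] := fH U R V Vf _ f fR fa.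
  split; first by apply: subset_trans bv _; exact: subsetDl.
  by apply: subset_trans be _; apply/subsetP => e; rewrite inE => /andP[].
exists e; split=> //; rewrite inE eH; apply/forallP => i.
apply: (subsetP bv); apply/bigcupP; exists (tnth f i); first exact: edges_verts fR i.
exact: (forallP pe).
Qed.

Lemma matchable_remove (m : nat) (T : finType) (H : mdigraph m T) (A S : {set T}) :
  matchable (remove H A) S -> matchable H S.
Proof.
move=> [es [esH ues ->]]; exists es; split=> // e /esH.
by rewrite inE => /andP[].
Qed.

Lemma exp_dominates m G : (0 < m)%N -> (0 < G)%N ->
  exists n0, forall n, (n0 <= n)%N -> (n ^ m < 2 ^ (n %/ G))%N.
Proof.
move=> m0 G0; set B := ((2 * m * G) ^ m)%N; exists (2 * m * G * B)%N => n nB.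
have P0 : (0 < 2 * m * G)%N by rewrite !muln_gt0 m0.
set a := (n %/ (2 * m * G))%N.
have aB : (B <= a)%N by rewrite leq_divRL // mulnC.
have na : (n <= 2 * m * G * a.+1)%N by rewrite mulnC ltnW // ltn_ceil.
have aq : (2 * m * a <= n %/ G)%N.
  rewrite leq_divRL // mulnAC; apply: leq_trans (leq_divM n (2 * m * G)).
  by rewrite mulnC.
apply: leq_ltn_trans (_ : B * a.+1 ^ m < _)%N.
  by rewrite -expnMn leq_exp2r.
apply: leq_trans (_ : 2 ^ (2 * m * a) <= _)%N; last by rewrite leq_exp2l.
have -> : (2 ^ (2 * m * a) = 2 ^ (m * a) * (2 ^ a) ^ m)%N.
  by rewrite -expnM -expnD; congr (_ ^ _)%N; lia.
apply: leq_trans (_ : 2 ^ (m * a) * a.+1 ^ m <= _)%N; last first.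
  by rewrite leq_mul2l leq_exp2r // ltn_expl ?orbT.
rewrite ltn_pmul2r ?expn_gt0 //.
apply: leq_trans (ltn_expl B (isT : (1 < 2)%N)) _; rewrite leq_exp2l //.
by rewrite (leq_trans aB) // leq_pmull.
Qed.

(** The product of [(1 - y) ^ (d + 1)] and [(1 + y) ^ (d + 1)] is at most 1, and Bernoulli's
    inequality makes the second factor at least 4. *)
Lemma exp_small (K : realType) (y : K) : 0 < y -> y <= 1 ->
  exists d, (1 - y) ^+ d.+1 <= 4%:R^-1.
Proof.
move=> y0 y1; have z0 : 0 <= 3%:R / y by rewrite divr_ge0 // ltW.
set d := Num.bound (3%:R / y); exists d.
have dy : 3%:R <= d.+1%:R * y.
  rewrite -ler_pdivrMr // (le_trans (ltW (archi_boundP z0))) // ler_nat.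
  exact: leqnSn.
have h1 : 1 + d.+1%:R * y <= (1 + y) ^+ d.+1.
  have y2 : 0 <= 1 + y by lra.
  have := bernoulli_tangent d y2 ler01; rewrite !expr1n mulr1; apply: le_trans; lra.
have h2 : (1 - y) ^+ d.+1 * (1 + y) ^+ d.+1 <= 1.
  rewrite -exprMn exprn_ile1 //.
    by rewrite mulr_ge0 //; lra.
  by rewrite -subr_sqr expr1n gerBl sqr_ge0.
have h3 : 0 <= (1 - y) ^+ d.+1 by rewrite exprn_ge0 // subr_ge0.
rewrite -[leRHS]mul1r ler_pdivlMr // (le_trans _ h2) // ler_wpM2l //.
apply: le_trans h1; lra.
Qed.

(** With [g = n %/ G], the greedy selection of [D * g] lists brings the potential down to
    [4 ^ (- g)], which beats the number [n ^ m] of lists [X]. *)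
Lemma exists_absorbers (K : realType) (m r : nat) (alpha : K) :
  (2 <= m)%N -> (m <= r)%N -> 0 < alpha ->
  exists G n1 : nat, (0 < G)%N /\
    forall (T : finType) (H : mdigraph m T), (n1 <= #|verts H|)%N -> fissile H ->
      robustly K r (fun F => Div F /\ Cov F) H ->
      exists Ws : seq (seq T),
        [/\ uniq (flatten Ws) /\ {subset flatten Ws <= verts H},
            (m %| size (flatten Ws))%N,
            (size (flatten Ws))%:R <= alpha * #|verts H|%:R /\
              (2 * size (flatten Ws) <= #|verts H|)%N,
            forall W, W \in Ws -> matchable H [set x in W]
          & forall X, uniq X -> {subset X <= verts H} -> size X = m ->
              (#|verts H| %/ G <= count (fun W => `[< absorbs H X W >]) Ws)%N].
Proof.
move=> m2 mr alpha0; have m0 : (0 < m)%N by lia.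
have [c [N [n1 [c0 c1 dense]]]] := absorb_density K m2 mr; set w := (m * N)%N in dense.
have [d hd] : exists d, (1 - c / 4%:R) ^+ d.+1 <= 4%:R^-1 by apply: exp_small; lra.
pose D := d.+1.
pose x1 : K := (D * w)%:R / alpha; pose x2 : K := (2 * D * w ^ 2)%:R / c.
have x10 : 0 <= x1 by rewrite divr_ge0 // ltW.
have x20 : 0 <= x2 by rewrite divr_ge0 // ltW.
(* The first bound keeps the absorbers within [alpha n] vertices, the second meets the size
   condition of [exists_family]. *)
pose G := (Num.bound x1 + Num.bound x2).+1.
have G0 : (0 < G)%N by [].
have Gx1 : (D * w)%:R <= alpha * G%:R.
  rewrite mulrC -ler_pdivrMr // (le_trans (ltW (archi_boundP x10))) // ler_nat.
  by rewrite /G; lia.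
have Gx2 : (2 * D * w ^ 2)%:R <= c * G%:R.
  rewrite mulrC -ler_pdivrMr // (le_trans (ltW (archi_boundP x20))) // ler_nat.
  by rewrite /G; lia.
have [n2 exp2] := exp_dominates m0 G0.
exists G, (n1 + n2 + (m ^ 2).+1)%N; split=> // T H nH fH rob.
set n := #|verts H| in nH *; pose g := (n %/ G)%N.
have n1n : (n1 <= n)%N by clear - nH; lia.
have n2n : (n2 <= n)%N by clear - nH; lia.
have mn : (m ^ 2 < n)%N by clear - nH; lia.
have gG : (g * G <= n)%N by exact: leq_divM.
have gGK : g%:R * G%:R <= n%:R :> K by rewrite -natrM ler_nat.
have gK : 0 <= g%:R :> K by [].
have sE : size (enum (verts H)) = n by rewrite -cardE.
have D0 : (0 < size (enum (verts H)))%N by rewrite sE (leq_trans _ mn).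
have Jw : ((D * g) * w ^ 2)%:R <= c / 2%:R * (size (enum (verts H)))%:R.
  have := ler_wpM2r gK Gx2; have := ler_wpM2l (ltW c0) gGK.
  rewrite sE !natrM; lra.
have dense' X : uniq X -> {subset X <= enum (verts H)} -> size X = m ->
    c <= avg (enum (verts H)) w (fun W => `[< absorbs H X W >]%:R).
  move=> uX XH sX; apply: dense => //.
  by move=> x /XH; rewrite mem_enum.
have relu X W : `[< absorbs H X W >] -> uniq W.
  by move=> /asboolP[]; rewrite cat_uniq => /and3P[].
have big : (m ^ 2 < size (enum (verts H)))%N by rewrite sE.
have [Ws [sWs uWs WsP pot]] := exists_family D0 (enum_uniq _) c0 c1 dense' relu big Jw.
have sF : size (flatten Ws) = (D * g * w)%N.
  rewrite size_flatten /shape -sWs; elim: (Ws) WsP => //= W Ws' IHW WsP.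
  rewrite IHW; first by case: (WsP W); rewrite ?inE ?eqxx // => ->.
  by move=> W' W's; apply: WsP; rewrite inE W's orbT.
exists Ws; split.
- split=> // x /flattenP[W /WsP[_ WH _] /WH]; by rewrite mem_enum.
- by rewrite sF /w mulnCA dvdn_mulr.
- rewrite sF; split.
    have := ler_wpM2r gK Gx1; have := ler_wpM2l (ltW alpha0) gGK.
    rewrite !natrM; lra.
  have h : (D * g * w <= D * g * w ^ 2)%N.
    by rewrite leq_mul2l -mulnn; apply/orP; right; case: (w) => // w'; rewrite leq_pmulr.
  rewrite -(ler_nat K) natrM; have : (D * g * w)%:R <= (D * g * w ^ 2)%:R :> K.
    by rewrite ler_nat.
  have : c * n%:R <= 1 * n%:R by rewrite ler_wpM2r.
  move: Jw; rewrite sE; lra.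
- by move=> W /WsP[_ _ [X /asboolP[]]].
(* Fewer than [g] absorbers would give [X] a weight of at least [2 ^ (- g)], but a single list
   weighs at most [n ^ m 4 ^ (- g)], which is smaller because [n ^ m < 2 ^ g]. *)
move=> X uX XH sX; rewrite -/g leqNgt; apply/negP => few.
pose F Y : K := (uniq Y)%:R * 2%:R^-1 ^+ count (fun W => `[< absorbs H Y W >]) Ws.
have F0 Y : 0 <= F Y by rewrite mulr_ge0 ?exprn_ge0 ?invr_ge0.
have XE : {subset X <= enum (verts H)} by move=> x /XH; rewrite mem_enum.
have := avg_single F0 sX XE; rewrite /F uX mul1r sE leNgt => /negP; apply.
apply: le_lt_trans (_ : n%:R ^+ m * (4%:R^-1 ^+ g) < _).
  rewrite ler_wpM2l ?exprn_ge0 //; apply: (le_trans pot).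
  rewrite exprM; apply: lerXn2r => //; rewrite nnegrE ?invr_ge0 //.
  by apply: exprn_ge0; lra.
apply: lt_le_trans (_ : 2%:R^-1 ^+ g <= _); last first.
  by apply: ler_wiXn2l; rewrite ?invr_ge0 ?invf_le1 ?ler1n // ltnW.
rewrite !exprVn ltr_pdivrMr ?exprn_gt0 // mulrC ltr_pdivlMr ?exprn_gt0 //.
rewrite -!natrX -natrM ltr_nat -[4%N]/(2 * 2)%N expnMn ltn_pmul2r ?expn_gt0 //.
by apply: exp2.
Qed.

Theorem theorem2p10 (K : realType) (m r : nat) (alpha : K) :
  (2 <= m)%N -> (m <= r)%N -> 0 < alpha ->
  exists2 rho : K, 0 < rho &
    forall s : nat, (m <= s)%N ->
      exists n0 : nat,
        forall (T : finType) (H : mdigraph m T),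
          (n0 <= #|verts H|)%N -> (m %| #|verts H|)%N ->
          fissile H ->
          robustly K r (fun G : mdigraph m T => Div G /\ Cov G) H ->
          (forall A : {set T}, A \subset verts H ->
             #|A|%:R <= alpha * #|verts H|%:R ->
             robustly K s (fun G : mdigraph m T => Spa G rho) (remove H A)) ->
          has_perfect_matching H.
Proof.
move=> m2 mr alpha0; have m0 : (0 < m)%N by lia.
have [G [n1 [G0 absorbers]]] := exists_absorbers m2 mr alpha0.
have GK : 0 < G%:R :> K by rewrite ltr0n.
have rho0 : 0 < (2 * G)%:R^-1 :> K by rewrite invr_gt0 ltr0n muln_gt0.
(* [G] comes from [m], [r] and [alpha] alone, so [rho] is fixed before [s]. The leftover has at most
   [n / (2 G)] vertices, within the capacity [n %/ G] of the absorbers. *)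
exists (2 * G)%:R^-1 => // s ms.
have rho1 : (2 * G)%:R^-1 <= 2%:R^-1 :> K.
  by rewrite lef_pV2 ?posrE ?ltr0n ?muln_gt0 // ler_nat leq_pmulr.
have [n2 almost] := uncovered_bound m2 ms rho0 rho1.
(* The absorbers occupy at most half of the vertices, so [remove H A] still has at least [n2] of
   them. *)
exists (n1 + 2 * n2)%N => T H nH mH fH robDC robS.
have [|Ws [[uW WH] mW [Walpha Whalf] Wm Wabs]] := absorbers T H _ fH robDC; first by lia.
pose A := [set x in flatten Ws].
have AH : A \subset verts H by apply/subsetP => x; rewrite inE => /WH.
have cA : #|A| = size (flatten Ws) by rewrite cardsE; apply/card_uniqP.
have vE : verts (remove H A) = verts H :\: A by [].
have cHA : #|verts (remove H A)| = (#|verts H| - size (flatten Ws))%N.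
  by rewrite vE cardsD (setIidPr AH) cA.
have [||||S mS few] := almost T (remove H A).
- by rewrite cHA; lia.
- by rewrite cHA dvdn_subr // -cA subset_leq_card.
- exact: fissile_remove.
- by apply: robS => //; rewrite cA.
have SH := matchable_sub mS; have {}mS := matchable_remove mS.
pose L := enum (verts (remove H A) :\: S).
have [es [esH ues SE]] := mS.
have cS : #|S| = (m * size es)%N.
  by rewrite SE cardsE -size_flatten_tuples; apply/card_uniqP.
have mL : (m %| size L)%N.
  rewrite -cardE cardsD (setIidPr SH) cS dvdn_sub ?dvdn_mulr //.
  by rewrite cHA dvdn_sub.
case/dvdnP: mL => g sL.
have gn : (g <= #|verts H| %/ G)%N.
  rewrite leq_divRL //; have : (2 * G * size L <= #|verts H|)%N.
    rewrite -(ler_nat K) mulnC natrM -ler_pdivlMr ?ltr0n ?muln_gt0 // -cardE.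
    apply: (le_trans few); rewrite mulrC ler_wpM2r // ?invr_ge0 // ler_nat.
    by rewrite cHA leq_subr.
  by rewrite sL => h; apply: leq_trans h; nia.
have uWL : uniq (flatten Ws ++ L).
  rewrite cat_uniq uW enum_uniq andbT; apply/hasPn => x.
  by rewrite mem_enum vE !inE => /and3P[].
have mAL : matchable H [set x in flatten Ws ++ L].
  apply: (absorb_all m0 Wm uWL sL) => X uX XL sX.
  apply: leq_trans gn (Wabs X uX _ sX) => x /XL.
  by rewrite mem_enum vE !inE => /and3P[].
apply: (matchable_perfect m0).
(* The perfect matching combines the almost perfect one on [S] with the one that [absorb_all] gives
   on the absorbers and the leftover [L]. *)
have -> : verts H = [set x in flatten Ws ++ L] :|: S.
  apply/setP => x; rewrite in_setU in_set mem_cat mem_enum in_setD vE in_setD.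
  have -> : (x \in flatten Ws) = (x \in A) by rewrite inE.
  apply/idP/idP => [->|]; first by case: (x \in S); case: (x \in A).
  case/orP => [/orP[/(subsetP AH)//|/and3P[]//]|/(subsetP SH)].
  by rewrite vE in_setD => /andP[].
apply: matchableU => //; apply/pred0P => x /=; rewrite in_set mem_cat mem_enum.
apply/negP => /andP[]; rewrite !in_setD => /orP[xW|/andP[/negbTE -> //]] xS.
by have := subsetP SH x xS; rewrite vE !inE xW.
Qed.
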